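(* Let $X$ be a Gaussian field on $(\mathcal T,\mu)$ with covariance $K$, and let $M=M(X)$ be a $\sigma(X)$-measurable random measure on $(\mathcal T,\mu)$. Then $M$ is a subcritical GMC over the field $X$ with expectation $\mathbb E M=\mu$ if and only if for every positive function $f=f(X,t)$, measurable with respect to the field $X$ and $t\in\mathcal T$, $$\mathbb E\int f(X,t)\,M(X,dt)=\mathbb E\int f\big(X+K(t,\cdot),t\big)\,\mu(dt).$$
   Context: $(\mathcal T,\mu)$ is a standard measurable space with a finite positive measure, and $(\Omega,\mathcal F,\mathbb P)$ is a standard probability space. Gaussian field: fix a finite measure $\nu$ on $\mathcal T$ equivalent to $\mu$. A Gaussian field $X$ on $(\mathcal T,\mu)$ (with test functions in $L^2(\nu)$) is a bounded linear map $g\mapsto X(g)$, written formally $X(g)=\int X(t)g(t)\,\nu(dt)$, from $L^2(\mathcal T,\nu)$ to $L^2(\Omega,\mathbb P)$ all of whose values are centered Gaussian (hence jointly Gaussian). $\sigma(X)$ is the ($\mathbb P$-completed) $\sigma$-algebra generated by all $X(g)$. Fix a countable orthonormal basis $(g_k)$ of $L^2(\nu)$ and identify $X$ with the random sequence $(X(g_k))_k$; a function $f(X,t)$ measurable with respect to $X$ and $t$ is a measurable function of $((X(g_k))_k,t)$. Covariance: $K$ is the formal kernel of the bounded operator $C$ on $L^2(\nu)$ given by $\int (Cg)h\,d\nu=\mathbb E[X(g)X(h)]$. The shifted field $X+K(t,\cdot)$ is the sequence $(X(g_k)+(Cg_k)(t))_k$, i.e. formally $\int K(t,s)g(s)\,\nu(ds)=(Cg)(t)$;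 it is defined for $\mu$-almost every $t$. Cameron–Martin space: let $G$ be the closed linear span of $\{X(g)\}$ in $L^2(\mathbb P)$; for $\eta\in G$ let $\xi_\eta\in L^2(\nu)$ be such that $\int\xi_\eta g\,d\nu=\mathbb E[\eta X(g)]$ for all $g\in L^2(\nu)$. $H:=\{\xi_\eta:\eta\in G\}$ is the Cameron–Martin space. Random measure: a random measure on $(\mathcal T,\mu)$ is a random positive finite measure $M$ such that $\mathbb E M\ll\mu$, where $(\mathbb E M)[A]:=\mathbb E(M[A])$. If $M$ is $\sigma(X)$-measurable, write $M=M(X)=m((X(g_k))_k)$ with $m$ measurable, and for $\xi\in H$ put $M(X+\xi):=m((X(g_k)+\int\xi g_k\,d\nu)_k)$, well-defined a.s. by the Cameron–Martin theorem. GMC: a Gaussian multiplicative chaos (GMC) over the field $X$ is a $\sigma(X)$-measurable random measure $M$ on $(\mathcal T,\mu)$ such that for every $\xi\in H$, $M(X+\xi,dt)=e^{\xi(t)}M(X,dt)$ almost surely. It is subcritical if $\mathbb E M$ is $\sigma$-finite. *)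

(* Defs.v *)
From HB Require Import structures.
From mathcomp Require Import all_boot all_order all_algebra.
From mathcomp Require Import all_classical all_reals all_analysis.
From mathcomp Require Import measurable_realfun.
Set Implicit Arguments.
Unset Strict Implicit.
Unset Printing Implicit Defensive.
Import Order.TTheory GRing.Theory Num.Theory.
Import numFieldNormedType.Exports.
Local Open Scope classical_set_scope.
Local Open Scope ring_scope.

(* Elements are square-integrable functions, not classes: two of them represent
   the same vector when they are equal almost everywhere. *)
Notation L2 mu := (LfunType mu (lee1n 2)).

Section standard_spaces.
Variable R : realType.

(* Isomorphic to the Borel space of a Polish space; the pseudometric of E is a
   metric because E is Hausdorff. *)
Definition standard_borel d (T : measurableType d) : Prop :=
  exists (E : completePseudoMetricType R) (f : T -> E),
    [/\ hausdorff_space E,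
        exists2 D : set E, countable D & dense D,
        bijective f
      & forall A : set T, measurable A <-> <<s @open E >> (f @` A)].

(* Isomorphic mod 0 to a Borel probability on a standard Borel space. The
   sigma-algebra may or may not be complete: both standard Borel probability
   spaces and their completions (Lebesgue-Rokhlin spaces) qualify. *)
Definition standard_probability d (Omega : measurableType d)
    (P : probability Omega R) : Prop :=
  exists (dE : measure_display) (E : measurableType dE) (f : {mfun Omega >-> E}),
    standard_borel E /\
    exists A : set Omega,
      [/\ measurable A, P A = 1%E, set_inj A f
        & forall B, measurable B -> B `<=` A ->
            completed_algebra_gen (pushforward P f) (f @` B)].

End standard_spaces.

Section hilbert.
Context d (T : measurableType d) (R : realType) (mu : {measure set T -> \bar R}).

Definition dotp (f h : L2 mu) : R := \int[mu]_t (f t * h t).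

Definition normL2 (f : L2 mu) : \bar R := Lnorm mu 2%:E (EFin \o f).

Definition closed_span (S : set (L2 mu)) : set (L2 mu) :=
  [set f | forall e : R, 0 < e ->
     exists (n : nat) (a : 'I_n -> R) (v : 'I_n -> L2 mu),
       (forall i, S (v i)) /\ (normL2 (f - \sum_i a i *: v i)%R < e%:E)%E].

(* The index type is finite when L^2 is finite-dimensional. *)
Definition orthonormal_basis (I : countType) (g : I -> L2 mu) : Prop :=
  (forall i j, dotp (g i) (g j) = (i == j)%:R) /\
  closed_span (range g) = setT.

End hilbert.

Definition cylinders (I : countType) (R : realType) : set (set (I -> R)) :=
  [set A | exists (i : I) (B : set R), measurable B /\ A = [set x | B (x i)]].

Definition seqspace (I : countType) (R : realType) :
    measurableType (sigma_display (@cylinders I R)) :=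
  g_sigma_algebraType (@cylinders I R).

Section gaussian_field.
Context d d' (T : measurableType d) (Omega : measurableType d') (R : realType).
Variables (nu : {finite_measure set T -> \bar R}) (P : probability Omega R).
Implicit Type X : L2 nu -> L2 P.

(* [normal_prob 0 0] is not a Dirac mass, hence the separate degenerate case;
   the second parameter of [normal_prob] is the standard deviation. *)
Definition centered_gaussian (Y : Omega -> R) : Prop :=
  (\forall w \ae P, Y w = 0) \/
  (exists2 s : R, 0 < s &
     forall B : set R, measurable B -> P (Y @^-1` B) = normal_prob 0 s B).

(* Linearity and boundedness imply that X is compatible with equality almost
   everywhere, i.e. that it is a map from L^2(nu) to L^2(P). *)
Definition gaussian_field X : Prop :=
  [/\ forall (a : R) (f h : L2 nu),
        \forall w \ae P, X (a *: f + h) w = a * X f w + X h w,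
      exists c : R, forall f, (normL2 (X f) <= c%:E * normL2 f)%E
    & forall f, centered_gaussian (X f)].

(* The P-completed sigma-algebra generated by all the X h. *)
Definition sigma_field X : set (set Omega) :=
  <<s [set A | exists (h : L2 nu) (B : set R),
                 measurable B /\ A = X h @^-1` B] `|` P.-negligible >>.

(* The identity determines C f up to nu-almost everywhere equality and forces C
   to be linear and bounded. *)
Definition covariance_operator X (C : L2 nu -> L2 nu) : Prop :=
  forall f h, dotp (C f) h = dotp (X f) (X h).

Definition cameron_martin X : set (L2 nu) :=
  [set xi | exists2 eta : L2 P, closed_span (range X) eta &
     forall h, dotp xi h = dotp eta (X h)].

Definition mean_measure (M : R.-ftker Omega ~> T) (A : set T) : \bar R :=
  (\int[P]_w M w A)%E.

Definition random_measure (mu : {finite_measure set T -> \bar R})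
    (M : R.-ftker Omega ~> T) : Prop :=
  mean_measure M `<< mu.

Definition field_measurable X (M : R.-ftker Omega ~> T) : Prop :=
  forall (A : set T) (B : set (\bar R)), measurable A -> measurable B ->
    sigma_field X [set w | B (M w A)].

Section coordinates.
Variables (I : countType) (g : I -> L2 nu).

Definition field_coord X (w : Omega) : seqspace I R := fun i => X (g i) w.

(* X + xi *)
Definition shift_cm X (xi : L2 nu) (w : Omega) : seqspace I R :=
  fun i => X (g i) w + dotp xi (g i).

(* X + K(t, .) *)
Definition shift_cov X (C : L2 nu -> L2 nu) (t : T) (w : Omega) :
    seqspace I R :=
  fun i => X (g i) w + C (g i) t.

(* M = m((X g_i)_i) almost surely. *)
Definition represents X (M : R.-ftker Omega ~> T)
    (m : R.-ftker seqspace I R ~> T) : Prop :=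
  \forall w \ae P, forall A : set T, measurable A ->
    M w A = m (field_coord X w) A.

(* m is the measurable function representing M, through which M(X + xi) is
   defined. *)
Definition gmc (mu : {finite_measure set T -> \bar R}) X
    (M : R.-ftker Omega ~> T) (m : R.-ftker seqspace I R ~> T) : Prop :=
  [/\ random_measure mu M,
      field_measurable X M,
      represents X M m
    & forall xi : L2 nu, cameron_martin X xi ->
        \forall w \ae P, forall A : set T, measurable A ->
          m (shift_cm X xi w) A = (\int[M w]_(t in A) (expR (xi t))%:E)%E].

Definition subcritical_gmc (mu : {finite_measure set T -> \bar R}) X
    (M : R.-ftker Omega ~> T) (m : R.-ftker seqspace I R ~> T) : Prop :=
  gmc mu X M m /\ sigma_finite setT (mean_measure M).

End coordinates.
End gaussian_field.

(* Main.v *)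
Require Import Defs.
From HB Require Import structures.
From mathcomp Require Import all_boot all_order all_algebra.
From mathcomp Require Import all_classical all_reals all_analysis.
From mathcomp Require Import measurable_realfun lra ring.
Import Order.TTheory GRing.Theory Num.Theory.
Import numFieldNormedType.Exports.
Local Open Scope classical_set_scope.
Local Open Scope ring_scope.
Set Implicit Arguments.
Unset Strict Implicit.

(** Everything rests on one uniqueness principle
    ([exponential_moments_unique]): two measures on the space of sequences with
    the same finite exponential moments, taken over all finite linear
    combinations of the coordinates, are equal. Exponentials produce monomials
    (as limits of difference quotients), monomials produce sines (by the power
    series), sines produce indicators of half-spaces, and each passage to the
    limit is dominated by exponentials.

    Since [E exp X(h) = exp (Var X(h) / 2)], also for [L^2] limits of the
    variables [X(h)] ([gaussian_limit_mgf]), this principle yields the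
    Cameron-Martin formula [E F(X + xi) = E F(X) exp (z - Var z / 2)], where [z]
    is the Gaussian variable which represents [xi].

    From chaos to Girsanov ([chaos_girsanov]): consider the Campbell measure
    [P(dw) M(w, dt)]. For a finite combination [z] of the [X(g_i)], with
    Cameron-Martin function [xi], the Cameron-Martin formula followed by the
    chaos property gives
      [E exp z \int_A exp (- xi(t)) M(dt)
        = exp (Var z / 2) E \int_A exp (- xi(t)) exp (xi(t)) M(dt)
        = exp (Var z / 2) mu(A)].
    On the left are the exponential moments of [X - K(t, .)] on [A]; on the
    right those of [X], multiplied by [mu(A)]. So under the Campbell measure
    [(X - K(t, .), t)] has the law of [X] times [mu], and adding [K(t, .)] back
    gives the formula.

    From Girsanov to chaos ([girsanov_chaos]): functions of [t] alone give
    [E M = mu]. For [xi] represented by [z], test [M(X + xi, A)] and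
    [\int_A exp (xi(t)) M(X, dt)] against functions [F(X + xi)]. The
    Cameron-Martin formula and the Girsanov formula turn both expectations into
      [E \int_A F(X + K(t, .)) exp (z + xi(t) - Var z / 2) mu(dt)];
    for the first one, note that [z], as a function of the field, becomes
    [z + xi(t)] under the shift by [K(t, .)]. Hence the two random measures agree
    almost surely on each set, and on all sets at once because a standard Borel
    space has a countable generating pi-system. *)

(** * Elementary limits *)

Lemma expRB1_le (R : realType) (z : R) : expR z - 1 <= z * expR z.
Proof.
have := expR_ge1Dx (- z); have := expR_gt0 z => e0 h.
have : (1 - z) * expR z <= expR (- z) * expR z by rewrite ler_pM2r.
rewrite -expRD addNr expR0; lra.
Qed.

Lemma norm_expRB1_le (R : realType) (z : R) :
  `|expR z - 1| <= `|z| * expR `|z|.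
Proof.
have h1 := expR_ge1Dx z; have h2 := expRB1_le z.
have [z0|z0] := leP 0 z.
  by rewrite !ger0_norm//; lra.
have e1 : expR z <= 1 by rewrite -expR0 ler_expR ltW.
rewrite ler0_norm ?subr_le0// (ltr0_norm z0).
have := expR_ge1Dx (- z) => h3; nra.
Qed.

(** A bound that does not depend on [n]: it dominates the limit
    [cvg_natexpRB1], through which exponentials produce monomials. *)
Lemma norm_natexpRB1_le (R : realType) (y : R) (n : nat) :
  `|n.+1%:R * (expR (y / n.+1%:R) - 1)| <= `|y| * expR `|y|.
Proof.
rewrite normrM ger0_norm//.
have hn : 0 < n.+1%:R :> R by [].
apply: (@le_trans _ _ (n.+1%:R * (`|y / n.+1%:R| * expR `|y / n.+1%:R|))).
  by rewrite ler_pM2l// norm_expRB1_le.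
rewrite normrM (ger0_norm (_ : 0 <= n.+1%:R^-1))// mulrA mulrCA divff ?mulr1//.
rewrite ler_wpM2l// ler_expR ler_pdivrMr// ler_peMr//.
by rewrite ler1n.
Qed.

Lemma cvg_natexpRB1 (R : realType) (y : R) :
  n.+1%:R * (expR (y / n.+1%:R) - 1) @[n --> \oo] --> y.
Proof.
have h0 : y / n.+1%:R @[n --> \oo] --> (0 : R).
  by rewrite -(mulr0 y); apply: cvgMl_tmp; exact: cvg_harmonic.
have h1 : y * expR (y / n.+1%:R) @[n --> \oo] --> y.
  have e : y = y * expR 0 by rewrite expR0 mulr1.
  rewrite [X in _ --> X]e; apply: cvgMl_tmp.
  exact: (cvg_comp _ _ h0 (@continuous_expR R 0)).
apply: (@squeeze_cvgr _ _ _ _ (cst y) _ _ _ _ _ h1); last exact: cvg_cst.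
near=> n; apply/andP; split.
  have := expR_ge1Dx (y / n.+1%:R).
  rewrite -lerBrDl => /(ler_wpM2l (ler0n R n.+1)).
  by rewrite mulrCA divff ?mulr1.
have /(ler_wpM2l (ler0n R n.+1)) := expRB1_le (y / n.+1%:R).
by rewrite mulrA mulrCA divff ?mulr1.
Unshelve. all: by end_near. Qed.

Lemma exp_ge_monomial (R : realType) (k : nat) (y : R) :
  `|y| ^+ k <= k`!%:R * expR `|y|.
Proof.
case: k => [|k]; first by rewrite expr0 fact0 mul1r -expR0 ler_expR.
have := @expR_ge1Dxn R `|y| k (normr_ge0 _) => h.
rewrite -ler_pdivrMl ?ltr0n ?fact_gt0// mulrC.
by apply: le_trans h; rewrite lerDr.
Qed.

Lemma expR_norm_le (R : realType) (y : R) : expR `|y| <= expR y + expR (- y).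
Proof.
have := expR_ge0 y; have := expR_ge0 (- y).
by case: (ger0P y) => _; lra.
Qed.

Lemma norm_series_sin_le (R : realType) (y : R) (n : nat) :
  `|series (sin_coeff y) n| <= expR `|y|.
Proof.
apply: (@le_trans _ _ (series (exp_coeff `|y|) n)).
  rewrite /series/= (le_trans (ler_norm_sum _ _ _))// ler_sum// => k _.
  rewrite sin_coeffE exp_coeffE !normrM normr_sign mulr1 normrX.

  rewrite ler_wpM2r ?exprn_ge0// !ger0_norm// ?invr_ge0//.
  by case: odd; rewrite ?mul1r ?mul0r.
rewrite /expR.
apply: nondecreasing_cvgn_le; last exact: is_cvg_series_exp_coeff.
apply/nondecreasing_seqP => m.
by rewrite /series/= big_nat_recr//= lerDl exp_coeff_ge0.
Qed.

Lemma cvg_series_sin (R : realType) (y : R) :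
  series (sin_coeff y) n @[n --> \oo] --> sin y.
Proof. by rewrite sin.unlock; exact: is_cvg_series_sin_coeff. Qed.

Lemma cvg_natMgeo (R : realType) (r : R) : 0 <= r < 1 ->
  n%:R * r ^+ n @[n --> \oo] --> (0 : R).
Proof.
move=> /andP[r0 r1]; pose c := 1 - r; have c0 : 0 < c by rewrite /c subr_gt0.
rewrite -cvg_shiftS /=.
have h0 : (2 / c ^+ 2) * n.+1%:R^-1 @[n --> \oo] --> (0 : R).
  by rewrite -(mulr0 (2 / c ^+ 2)); apply: cvgMl_tmp; exact: cvg_harmonic.
apply: (@squeeze_cvgr _ _ _ _ (cst 0) _ _ _ _ _ h0); last exact: cvg_cst.
near=> n; apply/andP; split; first by rewrite mulr_ge0// exprn_ge0.
have rc : r <= expR (- c) by have := expR_ge1Dx (- c); rewrite /c; lra.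
have n0 : 0 < n.+1%:R :> R by [].
have e0 : 0 < c * n.+1%:R by rewrite mulr_gt0.
have -> : 2 / c ^+ 2 * n.+1%:R^-1 = n.+1%:R * (2 / (c * n.+1%:R) ^+ 2).
  by field; rewrite nat1r pnatr_eq0 (gt_eqF c0).
rewrite ler_pM2l//.
apply: (@le_trans _ _ (expR (- c) ^+ n.+1)); first by rewrite lerXn2r// nnegrE// expR_ge0.
rewrite -expRM_natl mulrN expRN mulrC -[leRHS]invf_div.
rewrite lef_pV2 ?posrE ?divr_gt0 ?exprn_gt0 ?expR_gt0//.
have := @expR_ge1Dxn R (c * n.+1%:R) 1 (ltW e0).
by rewrite (_ : 2`! = 2)%N//; lra.
Unshelve. all: by end_near. Qed.

(** With [a = x ^ n] and [N = n 2 ^ n], the value lies between [1 - N a] and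
    [exp (- N a)], where [N a = n (2 x) ^ n] tends to [0] below [1 / 2] and to
    infinity from [1 / 2] on. The factor [n] in the exponent decides the case
    [x = 1 / 2]. *)
Lemma cvg_step_poly (R : realType) (x : R) : 0 <= x <= 1 ->
  (1 - x ^+ n) ^+ (n * 2 ^ n) @[n --> \oo] --> ((x < 1/2)%R%:R : R).
Proof.
move=> /andP[x0 x1].
have xn0 n : 0 <= x ^+ n by rewrite exprn_ge0.
have xn1 n : x ^+ n <= 1 by rewrite exprn_ile1.
have [xh|xh] := ltP x (1/2).
  have h0 : 1 - n%:R * (2 * x) ^+ n @[n --> \oo] --> (1 : R).
    rewrite -[X in _ --> X]subr0; apply: cvgB; first exact: cvg_cst.
    by apply: cvg_natMgeo; lra.
  apply: (@squeeze_cvgr _ _ _ _ _ (cst 1) _ _ _ h0); last exact: cvg_cst.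
  near=> n; apply/andP; split; last by rewrite exprn_ile1// ?subr_ge0// gerBl.
  rewrite exprMn mulrA -natrX -natrM.
  elim: (n * 2 ^ n)%N => [|k ih]; first by rewrite mul0r subr0 expr0.
  rewrite exprS -natr1.
  have k0 : 0 <= k%:R :> R by [].
  have := xn0 n; have := xn1 n; set a := x ^+ n; set b := (1 - _) ^+ k in ih *.
  rewrite -/a in ih; nra.
have h0 := @cvg_harmonic R.
rewrite -cvg_shiftS.
apply: (@squeeze_cvgr _ _ _ _ (cst 0) _ _ _ _ _ h0); last exact: cvg_cst.
near=> n; apply/andP; split; first by rewrite exprn_ge0// subr_ge0.
apply: (@le_trans _ _ (expR (- x ^+ n.+1) ^+ (n.+1 * 2 ^ n.+1))).
  by rewrite lerXn2r ?nnegrE ?subr_ge0 ?expR_ge0//; exact: expR_ge1Dx.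
rewrite -expRM_natl mulrN expRN lef_pV2 ?posrE ?expR_gt0//.
apply: (@le_trans _ _ (expR n.+1%:R)).
  by rewrite (le_trans _ (expR_ge1Dx _))// lerDr.
rewrite ler_expR natrM -mulrA ler_peMr// natrX -exprMn exprn_ege1//; lra.
Unshelve. all: by end_near. Qed.

(** * Classes of functions that contain exponentials *)

(* [Good] stands for the functions which two given measures integrate to the
   same finite value. *)
Section exponential_class.
Context (S : Type) (R : realType) (V Good : set (S -> R)).
Hypothesis VD : forall Y Z, V Y -> V Z -> V (fun x => Y x + Z x).
Hypothesis VZ : forall a Y, V Y -> V (fun x => a * Y x).
Hypothesis Vc : forall c, V (fun _ => c).
Hypothesis goodD : forall u v, Good u -> Good v -> Good (fun x => u x + v x).
Hypothesis goodZ : forall a u, Good u -> Good (fun x => a * u x).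
Hypothesis good_lim : forall (u : nat -> S -> R) v h,
  (forall n, Good (u n)) -> (forall x, u n x @[n --> \oo] --> v x) ->
  Good h -> (forall n x, `|u n x| <= h x) -> Good v.
Hypothesis good_exp : forall Y, V Y -> Good (fun x => expR (Y x)).

Let bounded (u : S -> R) := exists K, forall x, `|u x| <= K.

(* [Good] is not stable under products. The multipliers of the tilted functions
   are, while they keep the stability under bounded limits. *)
Let tilted : set (S -> R) := [set u | bounded u /\
  forall Y, V Y -> Good (fun x => u x * expR (Y x))].

Let multiplier : set (S -> R) := [set u | bounded u /\
  forall v, tilted v -> tilted (fun x => v x * u x)].

Let bounded_pos u : bounded u -> exists2 K, 0 <= K & forall x, `|u x| <= K.
Proof.
move=> [K uK]; exists `|K| => // x; exact: le_trans (uK x) (ler_norm _).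
Qed.

(* By induction on [k]: [Y] is the limit of the difference quotients
   [n (exp (Y / n) - 1)], and the factors [exp (Y / n)] are absorbed by [Z]. *)
Let good_moment u Y k : tilted u -> V Y ->
  forall Z, V Z -> Good (fun x => u x * Y x ^+ k * expR (Z x)).
Proof.
move=> tu VY; elim: k => [|k ih] Z VZ'.
  by under eq_fun do rewrite expr0 mulr1; exact: tu.2.
have [K K0 uK] := bounded_pos tu.1.
pose d n x := n.+1%:R * (expR (Y x / n.+1%:R) - 1).
apply: (@good_lim (fun n x => u x * Y x ^+ k * expR (Z x) * d n x) _
   (fun x => K * (k.+1)`!%:R * (expR (Z x + 2 * Y x) + expR (Z x + (-2) * Y x)))).
- move=> n.
  have -> : (fun x => u x * Y x ^+ k * expR (Z x) * d n x) =
    (fun x => n.+1%:R * (u x * Y x ^+ k * expR (Z x + n.+1%:R^-1 * Y x)) +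
              (- n.+1%:R) * (u x * Y x ^+ k * expR (Z x))).
    apply/funext => x; rewrite /d expRD [_^-1 * _]mulrC; ring.
  apply: goodD; apply: goodZ; last exact: ih.
  by apply: ih; apply: VD => //; exact: VZ.
- move=> x.
  have -> : u x * Y x ^+ k.+1 * expR (Z x) = u x * Y x ^+ k * expR (Z x) * Y x.
    by rewrite exprSr; ring.
  by apply: cvgMl_tmp; exact: cvg_natexpRB1.
- by apply: goodZ; apply: goodD; apply: good_exp; apply: VD => //; exact: VZ.
- move=> n x; rewrite !normrM normrX [`|expR _|]ger0_norm ?expR_ge0//.
  have h1 := norm_natexpRB1_le (Y x) n.
  have h2 := exp_ge_monomial k.+1 (Y x).
  have h3 : expR `|2 * Y x| <= expR (2 * Y x) + expR ((-2) * Y x).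
    by rewrite mulNr; exact: expR_norm_le.
  rewrite normrM ger0_norm// in h3.
  have e2 : expR (2 * `|Y x|) = expR `|Y x| * expR `|Y x|.
    by rewrite -expRD; congr expR; ring.
  rewrite !expRD -mulrDr.
  apply: (@le_trans _ _ (K * `|Y x| ^+ k * expR (Z x) * (`|Y x| * expR `|Y x|))).
    rewrite ler_pM ?mulr_ge0 ?exprn_ge0 ?expR_ge0//; last by rewrite -normrM.
    by rewrite ler_wpM2r ?expR_ge0// ler_wpM2r ?exprn_ge0.
  have -> : K * `|Y x| ^+ k * expR (Z x) * (`|Y x| * expR `|Y x|) =
     K * expR (Z x) * (`|Y x| ^+ k.+1 * expR `|Y x|) by rewrite exprS; ring.
  have -> : K * k.+1`!%:R * (expR (Z x) * (expR (2 * Y x) + expR (-2 * Y x))) =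
     K * expR (Z x) * (k.+1`!%:R * (expR (2 * Y x) + expR (-2 * Y x))) by ring.
  rewrite ler_wpM2l ?mulr_ge0 ?expR_ge0//.
  apply: (@le_trans _ _ (k.+1`!%:R * expR (2 * `|Y x|))).
    by rewrite e2 mulrA ler_wpM2r ?expR_ge0.
  by rewrite ler_wpM2l.
Qed.

Let multiplier_sin Y : V Y -> multiplier (fun x => sin (Y x)).
Proof.
move=> VY; split; first by exists 1 => x; rewrite ler_norml sin_geN1 sin_le1.
move=> u tu; have [K K0 uK] := bounded_pos tu.1; split.
  exists K => x; rewrite normrM -[leRHS]mulr1 ler_pM// ler_norml.
  by rewrite sin_geN1 sin_le1.
move=> Z VZ'.
apply: (@good_lim (fun n x => u x * series (sin_coeff (Y x)) n * expR (Z x)) _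
   (fun x => K * (expR (Z x + Y x) + expR (Z x + (-1) * Y x)))).
- elim=> [|n ih].
    have -> : (fun x => u x * series (sin_coeff (Y x)) 0 * expR (Z x)) =
      (fun x => 0 * expR (Z x)).
      by apply/funext => x; rewrite /series/= big_geq// mulr0.
    by apply: goodZ; exact: good_exp.
  have -> : (fun x => u x * series (sin_coeff (Y x)) n.+1 * expR (Z x)) =
    (fun x => u x * series (sin_coeff (Y x)) n * expR (Z x) +
      ((odd n)%:R * (-1) ^+ n.-1./2 / n`!%:R) * (u x * Y x ^+ n * expR (Z x))).
    apply/funext => x; rewrite /series/= big_nat_recr//= sin_coeffE; ring.
  by apply: goodD => //; apply: goodZ; exact: good_moment.
- move=> x; apply: cvgMr_tmp; apply: cvgMl_tmp; exact: cvg_series_sin.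
- by apply: goodZ; apply: goodD; apply: good_exp; apply: VD => //; exact: VZ.
- move=> n x; rewrite !normrM [`|expR _|]ger0_norm ?expR_ge0//.
  rewrite !expRD -mulrDr [expR _ * (_ + _)]mulrC mulrA.
  rewrite ler_wpM2r ?expR_ge0// ler_pM//.
  rewrite (le_trans (norm_series_sin_le _ _))// mulN1r; exact: expR_norm_le.
Qed.

Let multiplier_lim (u : nat -> S -> R) v K :
  (forall n, multiplier (u n)) -> (forall n x, `|u n x| <= K) ->
  (forall x, u n x @[n --> \oo] --> v x) -> multiplier v.
Proof.
move=> mu uK uv.
have vK x : `|v x| <= K.
  have /(cvg_lim (@norm_hausdorff _ _)) <- : `|u n x| @[n --> \oo] --> `|v x|.
    exact: cvg_norm.
  apply: limr_le; last by apply: nearW.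
  by apply/cvg_ex; eexists; apply: cvg_norm; exact: uv.
split; first by exists K.
move=> w tw; have [L L0 wL] := bounded_pos tw.1; split.
  by exists (L * K) => x; rewrite normrM ler_pM.
move=> Y VY.
apply: (@good_lim (fun n x => w x * u n x * expR (Y x)) _
  (fun x => L * K * expR (Y x))).
- by move=> n; apply: ((mu n).2 _ tw).2.
- by move=> x; apply: cvgMr_tmp; apply: cvgMl_tmp; exact: uv.
- by apply: goodZ; exact: good_exp.
- move=> n x; rewrite !normrM [`|expR _|]ger0_norm ?expR_ge0//.
  by rewrite ler_wpM2r ?expR_ge0// ler_pM.
Qed.

Let multiplierM u v : multiplier u -> multiplier v ->
  multiplier (fun x => u x * v x).
Proof.
move=> mu mv; split.
  have [K K0 uK] := bounded_pos mu.1; have [L L0 vL] := bounded_pos mv.1.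
  by exists (K * L) => x; rewrite normrM ler_pM.
move=> w tw; under eq_fun do rewrite mulrA.
exact/mv.2/mu.2.
Qed.

Let multiplier_comb a b u v : multiplier u -> multiplier v ->
  multiplier (fun x => a * u x + b * v x).
Proof.
have bnd u' v' : bounded u' -> bounded v' -> bounded (fun x => a * u' x + b * v' x).
  move=> [K uK] [L vL]; exists (`|a| * K + `|b| * L) => x.
  by rewrite (le_trans (ler_normD _ _))// !normrM lerD// ler_wpM2l.
move=> mu mv; split; first by apply: bnd; [exact: mu.1|exact: mv.1].
move=> w tw.
have -> : (fun x => w x * (a * u x + b * v x)) =
    (fun x => a * (w x * u x) + b * (w x * v x)).
  by apply/funext => x; ring.
have [b1 g1] := mu.2 _ tw; have [b2 g2] := mv.2 _ tw.
split; first exact: bnd.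
move=> Y VY; under eq_fun do rewrite mulrDl -!mulrA.
apply: goodD; apply: goodZ; under eq_fun do rewrite mulrA.
  exact: g1.
exact: g2.
Qed.

Let multiplier1 : multiplier (fun _ => 1).
Proof.
split; first by exists 1 => x; rewrite normr1.
by move=> v tv; under eq_fun do rewrite mulr1.
Qed.

Let multiplierX u n : multiplier u -> multiplier (fun x => u x ^+ n).
Proof.
move=> mu; elim: n => [|n ih]; first by under eq_fun do rewrite expr0.
by under eq_fun do rewrite exprS; exact: multiplierM.
Qed.

(* half of [1 + sin] lies in the unit interval, and below [1 / 2] exactly when
   the sine is negative *)
Let multiplier_sin_neg Y : V Y ->
  multiplier (fun x => ((sin (Y x) < 0)%R)%:R).
Proof.
move=> VY.
pose h x := (1/2) * 1 + (1/2) * sin (Y x).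
have h01 x : 0 <= h x <= 1.
  by rewrite /h; have := sin_geN1 (Y x); have := sin_le1 (Y x); lra.
have mh : multiplier h by apply: multiplier_comb => //; exact: multiplier_sin.
have -> : (fun x => ((sin (Y x) < 0)%R)%:R) =
    (fun x => ((h x < 1/2)%R)%:R) :> (S -> R).
  by apply/funext => x; congr (_%:R); congr nat_of_bool; rewrite /h; apply/idP/idP; lra.
apply: (@multiplier_lim (fun n x => (1 * 1 + (-1) * h x ^+ n) ^+ (n * 2 ^ n)) _ 1).
- by move=> n; apply: multiplierX; apply: multiplier_comb => //; exact: multiplierX.
- move=> n x; rewrite mulr1 mulN1r ger0_norm.
    have /andP[? ?] := h01 x.
    by rewrite exprn_ile1// ?gerBl ?exprn_ge0// subr_ge0 exprn_ile1.
  by have /andP[? ?] := h01 x; rewrite exprn_ge0// subr_ge0 exprn_ile1.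
- by move=> x; under eq_cvg do rewrite mulr1 mulN1r; exact: cvg_step_poly.
Qed.

(* [sin (Y / n)] has the sign of [Y] as soon as [n] exceeds the norm of [Y]. *)
Let multiplier_neg Y : V Y -> multiplier (\1_[set x | Y x < 0]).
Proof.
move=> VY.
apply: (@multiplier_lim (fun n x => ((sin (n.+1%:R^-1 * Y x) < 0)%R)%:R) _ 1).
- by move=> n; apply: multiplier_sin_neg; exact: VZ.
- by move=> n x; case: ltP; rewrite ?normr1 ?normr0.
- move=> x; apply: cvg_near_cst.
  have h0 : n.+1%:R^-1 * Y x @[n --> \oo] --> (0 : R).
    by rewrite -(mul0r (Y x)); apply: cvgMr_tmp; exact: cvg_harmonic.
  have hn : \forall n \near \oo, `|n.+1%:R^-1 * Y x| < 1.
    by apply: (cvgr0_norm_lt _ h0).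
  near=> n.
  have hb : `|n.+1%:R^-1 * Y x| < 1 by near: n.
  have n0 : 0 < n.+1%:R^-1 :> R by [].
  rewrite indicE; congr (_%:R).
  have -> : (x \in [set x | Y x < 0]) = (n.+1%:R^-1 * Y x < 0).
    by rewrite pmulr_rlt0//; apply/idP/idP => [/set_mem|/mem_set].
  move: hb; rewrite ltr_norml; set z := _ * Y x => /andP[z1 z2].
  have [z0|z0|->] := ltrgtP z 0; last by rewrite sin0 ltxx.
    by rewrite -oppr_gt0 -sinN sin2_gt0//; lra.
  by rewrite ltNge ltW// sin2_gt0//; lra.
Unshelve. all: by end_near. Qed.

(** The sets whose indicator is a multiplier form a sigma-algebra: products give
    intersections, bounded limits give countable unions. *)
Lemma good_indic (A : set S) :
  <<s [set [set x | Y x < 0] | Y in V] >> A -> Good \1_A.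
Proof.
have t1 : tilted (fun _ => 1).
  split; first by exists 1 => x; rewrite normr1.
  by move=> Y VY; under eq_fun do rewrite mul1r; exact: good_exp.
suff h : <<s [set [set x | Y x < 0] | Y in V] >> `<=` [set A | multiplier \1_A].
  move=> /h /= [_ /(_ _ t1)] [_ /(_ _ (Vc 0))].
  by under eq_fun do rewrite expR0 mulr1 mul1r.
have mC B : multiplier \1_B -> multiplier \1_(~` B).
  move=> mB; have -> : \1_(~` B) = (fun x => 1 * 1 + (-1) * \1_B x) :> (S -> R).
    by apply/funext => x; rewrite !indicE in_setC; case: (x \in B) => /=; ring.
  exact: multiplier_comb.
have mI B C : multiplier \1_B -> multiplier \1_C -> multiplier \1_(B `&` C).
  by move=> mB mD; rewrite indicI; exact: multiplierM.
apply: smallest_sub; last by move=> _ [Y VY <-]; exact: multiplier_neg.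
split => /=.
- rewrite -setCT; apply: mC.
  by rewrite indicT; exact: multiplier1.
- by move=> B mB; rewrite setTD; exact: mC.
move=> F mF; apply: (@multiplier_lim (fun n => \1_(\big[setU/set0]_(i < n) F i)) _ 1).
- elim=> [|n ih].
    by rewrite big_ord0 -setCT; apply: mC; rewrite indicT; exact: multiplier1.
  rewrite big_ord_recr/= -[X in \1_X]setCK setCU; apply: (mC).
  by apply: mI; exact: mC.
- by move=> n x; rewrite indicE; case: (_ \in _); rewrite ?normr1 ?normr0.
- move=> x; apply: cvg_near_cst.
  have [[k _ Fk]|nF] := pselect ((\bigcup_k F k) x).
    exists k.+1 => // n /= kn; rewrite !indicE mem_set; last first.
      by rewrite -bigcup_mkord; exists k.
    by rewrite mem_set//; exists k.
  exists 0%N => // n _; rewrite !indicE memNset ?memNset//.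
  by move=> Fx; apply: nF; move: Fx; rewrite -bigcup_mkord => -[k _ ?]; exists k.
Qed.

End exponential_class.

(** * Integration of nonnegative functions *)

Section ge0_induction.
Context d (T : measurableType d) (R : realType).
Import HBNNSimple.

(** Passage through simple functions and increasing limits: an identity between
    integrals has to be checked on indicators only. *)
Lemma ge0_measurable_ind (Pr : (T -> \bar R) -> Prop) :
  (forall A, measurable A -> Pr (fun x => (\1_A x)%:E)) ->
  (forall f h, measurable_fun setT f -> measurable_fun setT h ->
     (forall x, (0 <= f x)%E) -> (forall x, (0 <= h x)%E) ->
     Pr f -> Pr h -> Pr (fun x => (f x + h x)%E)) ->
  (forall r f, 0 <= r -> measurable_fun setT f -> (forall x, (0 <= f x)%E) ->
     Pr f -> Pr (fun x => (r%:E * f x)%E)) ->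
  (forall (f_ : nat -> T -> \bar R) f, (forall n, measurable_fun setT (f_ n)) ->
     (forall n x, (0 <= f_ n x)%E) ->
     (forall x, {homo f_ ^~ x : n m / (n <= m)%N >-> (n <= m)%E}) ->
     (forall x, f_ n x @[n --> \oo] --> f x) ->
     (forall n, Pr (f_ n)) -> Pr f) ->
  forall f, measurable_fun setT f -> (forall x, (0 <= f x)%E) -> Pr f.
Proof.
move=> Pi PD PZ Pl f mf f0.
pose f_ := nnsfun_approx measurableT mf.
apply: (Pl (fun n x => (f_ n x)%:E)).
- by move=> n; exact/measurable_EFinP.
- by move=> n x; rewrite lee_fin.
- by move=> x m n mn; rewrite lee_fin; exact/lefP/nd_nnsfun_approx.
- by move=> x; apply: cvg_nnsfun_approx.
move=> n; set h := f_ n.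
have -> : (fun x => (h x)%:E) =
   (fun x => \sum_(y <- finmap.enum_fset (fset_set (range h)))
      (y%:E * (\1_(h @^-1` [set y]) x)%:E))%E.
  apply/funext => x; rewrite fimfunE fsbig_finite//= -sumEFin.
  by apply: eq_bigr => y _; rewrite EFinM.
have : {in finmap.enum_fset (fset_set (range h)), forall y, 0 <= y}.
  by move=> y; rewrite in_fset_set// inE => -[x _ <-].
elim: (finmap.enum_fset _) => [_|y s ih ys].
  have -> : (fun x : T => \sum_(y <- [::]) (y%:E * (\1_(h @^-1` [set y]) x)%:E))%E
      = (fun x => (\1_set0 x)%:E).
    by apply/funext => x; rewrite big_nil indic0.
  exact: Pi.
have y0 : 0 <= y by apply: ys; rewrite inE eqxx.
have ys' : {in s, forall y, 0 <= y} by move=> z zs; apply: ys; rewrite inE zs orbT.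
have mh z : measurable_fun setT (fun x => (\1_(h @^-1` [set z]) x)%:E).
  exact/measurable_EFinP.
under eq_fun do rewrite big_cons.
apply: PD.
- exact: measurable_funeM.
- by apply: emeasurable_sum => z _; exact: measurable_funeM.
- by move=> x; rewrite mule_ge0// lee_fin.
- move=> x; rewrite big_seq_cond sume_ge0// => z /andP[zs _].
  by rewrite mule_ge0// lee_fin// ys'.
- by apply: PZ => //; exact: Pi.
- exact: ih.
Qed.

End ge0_induction.

Lemma cvg_ge0_integral d (T : measurableType d) (R : realType)
    (m : {measure set T -> \bar R}) (f_ : nat -> T -> \bar R) f :
  (forall n, measurable_fun setT (f_ n)) -> (forall n x, (0 <= f_ n x)%E) ->
  (forall x, {homo f_ ^~ x : n m / (n <= m)%N >-> (n <= m)%E}) ->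
  (forall x, f_ n x @[n --> \oo] --> f x) ->
  (\int[m]_x f_ n x)%E @[n --> \oo] --> (\int[m]_x f x)%E.
Proof.
move=> mf f0 nd fl.
have -> : (\int[m]_x f x = \int[m]_x limn (f_ ^~ x))%E.
  by apply: eq_integral => x _; apply/esym/cvg_lim => //; exact: fl.
by apply: cvg_monotone_convergence => // x _; exact: nd.
Qed.

Lemma integral_density d (T : measurableType d) (R : realType)
    (m m' : {measure set T -> \bar R}) (h : T -> R) :
  measurable_fun setT h -> (forall x, 0 <= h x) ->
  (forall A, measurable A -> m' A = \int[m]_(x in A) (h x)%:E)%E ->
  forall f, measurable_fun setT f -> (forall x, (0 <= f x)%E) ->
  (\int[m']_x f x = \int[m]_x (f x * (h x)%:E))%E.
Proof.
move=> /measurable_EFinP mh h0 mm'.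
apply: ge0_measurable_ind =>
  [A mA|f g mf mg f0 g0 If Ig|r f r0 mf f0 If|f_ f mf f0 nd fl If].
- rewrite integral_indic// setIT mm'// [LHS]integral_mkcond.
  by apply: eq_integral => x _; rewrite patchE indicE; case: ifP; rewrite ?mul1e ?mul0e.
- rewrite ge0_integralD// If Ig -ge0_integralD//.
  + by apply: eq_integral => x _; rewrite ge0_muleDl.
  + by move=> x _; rewrite mule_ge0// lee_fin.
  + exact: emeasurable_funM.
  + by move=> x _; rewrite mule_ge0// lee_fin.
  + exact: emeasurable_funM.
- rewrite ge0_integralZl_EFin// If -ge0_integralZl_EFin//.
  + by apply: eq_integral => x _; rewrite muleA.
  + by move=> x _; rewrite mule_ge0// lee_fin.
  + exact: emeasurable_funM.
- have := @cvg_ge0_integral _ _ _ m' _ _ mf f0 nd fl; rewrite (eq_cvg _ _ If).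
  move=> /(cvg_unique _); apply => //.
  apply: cvg_ge0_integral.
  + by move=> n; exact: emeasurable_funM.
  + by move=> n x; rewrite mule_ge0// lee_fin.
  + by move=> x a b ab; rewrite lee_wpmul2r ?lee_fin//; exact: nd.
  + by move=> x; apply: cvgeZr => //; exact: fl.
Qed.

(** * The Campbell measure of a kernel *)

Section campbell.
Context d d' (Z : measurableType d) (T : measurableType d') (R : realType).
Variables (P : {measure set Z -> \bar R}) (k : R.-ftker Z ~> T).

(** The measure [P(dz) k(z, dt)]; for a chaos it is also known as the Peyriere
    measure. *)
Definition campbell (A : set (Z * T)) : \bar R :=
  (\int[P]_z k z (xsection A z))%E.

Lemma measurable_xsection_ftker (A : set (Z * T)) : measurable A ->
  measurable_fun setT (fun z => k z (xsection A z)).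
Proof.
move=> mA; rewrite -kfcompkindic//; apply: measurable_kfcomp => //.
  exact/measurable_EFinP.
by move=> z; rewrite /= lee_fin.
Qed.

Let campbell0 : campbell set0 = 0%E.
Proof. by rewrite /campbell integral0_eq// => z _; rewrite xsection0 measure0. Qed.

Let campbell_ge0 A : (0 <= campbell A)%E.
Proof. by apply: integral_ge0. Qed.

Let campbell_sigma_additive : semi_sigma_additive campbell.
Proof.
move=> F mF tF mUF.
have -> : campbell (\bigcup_n F n) = (\sum_(n <oo) campbell (F n))%E.
  rewrite /campbell -integral_nneseries//; last first.
    by move=> n; exact: measurable_xsection_ftker.
  apply: eq_integral => z _; rewrite xsection_bigcup.
  rewrite measure_semi_bigcup//; first last.
  - by apply: bigcup_measurable => n _; exact: measurable_xsection.
  - exact: trivIset_xsection.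
  by move=> n; exact: measurable_xsection.
by apply: is_cvg_ereal_nneg_natsum => n _; exact: campbell_ge0.
Qed.

HB.instance Definition _ := isMeasure.Build _ _ R campbell
  campbell0 campbell_ge0 campbell_sigma_additive.

Lemma integral_campbell (f : Z * T -> \bar R) : measurable_fun setT f ->
  (forall x, (0 <= f x)%E) ->
  (\int[campbell]_x f x = \int[P]_z \int[k z]_t f (z, t))%E.
Proof.
have mkf h : measurable_fun setT h -> (forall x, (0 <= h x)%E) ->
    measurable_fun setT (fun z => \int[k z]_t h (z, t))%E.
  by move=> mh h0; exact: measurable_kfcomp.
have mpair (h : Z * T -> \bar R) z :
    measurable_fun setT h -> measurable_fun setT (fun t : T => h (z, t)).
  by move=> mh; exact: measurable_fun_pair2.
move: f; apply: ge0_measurable_ind =>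
  [A mA|f g mf mg f0 g0 If Ig|r f r0 mf f0 If|f_ f mf f0 nd fl If].
- rewrite integral_indic// setIT; apply: eq_integral => z _.
  by have /(congr1 (fun f => f z)) := @kfcompkindic _ _ _ _ R k A mA.
- rewrite ge0_integralD// If Ig -ge0_integralD//; last 4 first.
  + by move=> z _; apply: integral_ge0.
  + exact: mkf.
  + by move=> z _; apply: integral_ge0.
  + exact: mkf.
  by apply: eq_integral => z _; rewrite ge0_integralD//; exact: mpair.
- rewrite ge0_integralZl_EFin// If -ge0_integralZl_EFin//; last 2 first.
  + by move=> z _; apply: integral_ge0.
  + exact: mkf.
  by apply: eq_integral => z _; rewrite ge0_integralZl_EFin//; exact: mpair.
- have := @cvg_ge0_integral _ _ _ campbell _ _ mf f0 nd fl; rewrite (eq_cvg _ _ If).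
  move=> /(cvg_unique _); apply => //.
  apply: cvg_ge0_integral.
  + by move=> n; exact: mkf.
  + by move=> n z; apply: integral_ge0.
  + move=> z a b ab; apply: ge0_le_integral => //; [exact: mpair|exact: mpair|].
    by move=> t _; exact: nd.
  + by move=> z; apply: cvg_ge0_integral => // n; exact: mpair.
Qed.

End campbell.

(** * Exponential moments determine a measure on sequences *)

Section seqspace.
Context (I : countType) (R : realType).

Lemma measurable_coord (i : I) :
  measurable_fun setT (fun x : seqspace I R => x i).
Proof.
move=> _ B mB; rewrite setTI; apply: sub_sigma_algebra.
by exists i, B.
Qed.

Lemma measurable_to_seqspace d (Z : measurableType d) (p : Z -> seqspace I R) :
  (forall i, measurable_fun setT (fun z => p z i)) -> measurable_fun setT p.
Proof.
move=> mp; apply: (@measurability _ _ Z (seqspace I R) setT p (@cylinders I R)) => //.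
move=> _ [_ [i [B [mB ->]]] <-].
exact: mp.
Qed.

Definition coord_comb (s : seq (I * R)) (x : seqspace I R) : R :=
  \sum_(q <- s) q.2 * x q.1.

Lemma measurable_coord_comb s : measurable_fun setT (coord_comb s).
Proof.
apply: measurable_sum => q; apply: measurable_funM => //.
exact: measurable_coord.
Qed.

Definition affine_comb : set (seqspace I R -> R) :=
  [set Y | exists s c, Y = fun x => coord_comb s x + c].

Lemma seqspace_halfspaces (A : set (seqspace I R)) : measurable A ->
  <<s [set [set x | Y x < 0] | Y in affine_comb] >> A.
Proof.
set H := (X in <<s X >>).
have [H0 HC HU] := smallest_sigma_algebra setT H.
apply: smallest_sub; first by split.
move=> _ [i [B [mB ->]]].
suff : @measurable _ R `<=` [set B | <<s H >> [set x : seqspace I R | B (x i)]].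
  by apply.
have -> : @measurable _ R = <<s @RGenInftyO.G R >>.
  exact: RGenInftyO.measurableE.
apply: smallest_sub.
  split => [|C hC|F hF].
  - exact: H0.
  - by have := HC _ hC; rewrite !setTD.
  - have e : [set x : seqspace I R | (\bigcup_k F k) (x i)] =
       \bigcup_k [set x : seqspace I R | F k (x i)].
      by apply/seteqP; split=> x [k _ ?]; exists k.
    by move: (HU _ hF); rewrite -e.
move=> _ [r ->]; apply: sub_sigma_algebra.
exists (fun x => coord_comb [:: (i, 1)] x + (- r)); first by exists [:: (i, 1)], (- r).
apply/seteqP; split => x /=; rewrite /coord_comb big_seq1 /= mul1r in_itv/= subr_lt0//.
Qed.

End seqspace.

Section exponential_moments.
Context (I : countType) (R : realType) d1 d2 (Z1 : measurableType d1)
  (Z2 : measurableType d2).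
Variables (m1 : {measure set Z1 -> \bar R}) (m2 : {measure set Z2 -> \bar R}).
Variables (p1 : Z1 -> seqspace I R) (p2 : Z2 -> seqspace I R).
Variables (w1 : Z1 -> R) (w2 : Z2 -> R).
Hypotheses (mp1 : measurable_fun setT p1) (mp2 : measurable_fun setT p2).
Hypotheses (mw1 : measurable_fun setT w1) (mw2 : measurable_fun setT w2).
Hypotheses (w1_ge0 : forall z, 0 <= w1 z) (w2_ge0 : forall z, 0 <= w2 z).
Hypothesis exp_fin : forall s,
  (\int[m1]_z (w1 z * expR (coord_comb s (p1 z)))%:E < +oo)%E.
Hypothesis exp_eq : forall s,
  (\int[m1]_z (w1 z * expR (coord_comb s (p1 z)))%:E =
   \int[m2]_z (w2 z * expR (coord_comb s (p2 z)))%:E)%E.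

Let good (u : seqspace I R -> R) :=
  [/\ measurable_fun setT u,
      m1.-integrable setT (fun z => (w1 z * u (p1 z))%:E),
      m2.-integrable setT (fun z => (w2 z * u (p2 z))%:E)
    & (\int[m1]_z (w1 z * u (p1 z))%:E = \int[m2]_z (w2 z * u (p2 z))%:E)%E].

Let goodD u v : good u -> good v -> good (fun x => u x + v x).
Proof.
move=> [mu i1 i2 e] [mv j1 j2 f].
split; first exact: measurable_funD.
- under eq_fun do rewrite mulrDr EFinD; exact: integrableD.
- under eq_fun do rewrite mulrDr EFinD; exact: integrableD.
- under eq_integral do rewrite mulrDr EFinD.
  under [RHS]eq_integral do rewrite mulrDr EFinD.
  by rewrite !integralD_EFin// e f.
Qed.

Let goodZ a u : good u -> good (fun x => a * u x).
Proof.
move=> [mu i1 i2 e].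
split; first exact: measurable_funM.
- under eq_fun do rewrite mulrCA EFinM; exact: integrableZl.
- under eq_fun do rewrite mulrCA EFinM; exact: integrableZl.
- under eq_integral do rewrite mulrCA EFinM.
  under [RHS]eq_integral do rewrite mulrCA EFinM.
  by rewrite !integralZl// e.
Qed.

Let good_lim (u : nat -> seqspace I R -> R) v h :
  (forall n, good (u n)) -> (forall x, u n x @[n --> \oo] --> v x) ->
  good h -> (forall n x, `|u n x| <= h x) -> good v.
Proof.
move=> gu uv [mh h1 h2 eh] uh.
have mv : measurable_fun setT v.
  apply: (@measurable_fun_cvg _ _ _ _ u) => [n|x _]; last exact: uv.
  by have [] := gu n.
have dct d (Z : measurableType d) (m : {measure set Z -> \bar R})
    (p : Z -> seqspace I R) (w : Z -> R) :
    measurable_fun setT p -> measurable_fun setT w -> (forall z, 0 <= w z) ->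
    (forall n, measurable_fun setT (fun z => (w z * u n (p z))%:E)) ->
    m.-integrable setT (fun z => (w z * h (p z))%:E) ->
    m.-integrable setT (fun z => (w z * v (p z))%:E) /\
    (\int[m]_z (w z * u n (p z))%:E)%E @[n --> \oo] -->
    (\int[m]_z (w z * v (p z))%:E)%E.
  move=> mp mw w0 mun ih.
  have [] := @dominated_convergence _ Z R m setT measurableT
    (fun n z => (w z * u n (p z))%:E) (fun z => (w z * v (p z))%:E)
    (fun z => (w z * h (p z))%:E) mun _ _ ih _ => //.
  - by apply/measurable_EFinP; apply: measurable_funM => //; exact: measurableT_comp.
  - apply: aeW => z _; apply: cvg_EFin; first exact: nearW.
    by apply: cvgMl_tmp; exact: uv.
  - apply: aeW => z n _; rewrite /= lee_fin normrM ger0_norm//.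
    by rewrite ler_wpM2l.
have [|i1 c1] := dct _ _ m1 p1 w1 mp1 mw1 w1_ge0 _ h1.
  by move=> n; have [_ /measurable_int] := gu n.
have [|i2 c2] := dct _ _ m2 p2 w2 mp2 mw2 w2_ge0 _ h2.
  by move=> n; have [_ _ /measurable_int] := gu n.
split => //.
apply: (cvg_unique _ c1) => //.
rewrite (_ : (fun n => _) = (fun n => \int[m2]_z (w2 z * u n (p2 z))%:E)%E)//.
by apply/funext => n; have [] := gu n.
Qed.

Let good_exp Y : affine_comb Y -> good (fun x => expR (Y x)).
Proof.
move=> [s [c ->]].
under eq_fun do rewrite expRD mulrC.
apply: goodZ.
have mE : measurable_fun setT (fun x : seqspace I R => expR (coord_comb s x)).
  by apply: measurableT_comp => //; exact: measurable_coord_comb.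
split => //.
- apply/integrableP; split.
    apply/measurable_EFinP; apply: measurable_funM => //.
    by apply: (measurableT_comp mE).
  by under eq_integral do rewrite gee0_abs ?lee_fin ?mulr_ge0 ?expR_ge0//.
- apply/integrableP; split.
    apply/measurable_EFinP; apply: measurable_funM => //.
    by apply: (measurableT_comp mE).
  under eq_integral do rewrite gee0_abs ?lee_fin ?mulr_ge0 ?expR_ge0//.
  by rewrite -exp_eq.
Qed.

(** The two measures are given as weighted images of [m1] and [m2], so that the
    lemma applies to a density on a probability space as well as to the
    restriction of a measure on a product to a set of values of [t]. *)
Lemma exponential_moments_unique (F : seqspace I R -> \bar R) :
  measurable_fun setT F -> (forall x, (0 <= F x)%E) ->
  (\int[m1]_z ((w1 z)%:E * F (p1 z)) = \int[m2]_z ((w2 z)%:E * F (p2 z)))%E.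
Proof.
have gI A : measurable A -> good \1_A.
  move=> mA; apply: (@good_indic _ _ (@affine_comb I R) good) => //.
  - move=> _ _ [s [c ->]] [t [e ->]]; exists (s ++ t), (c + e).
    by apply/funext => x; rewrite /coord_comb big_cat/=; ring.
  - move=> a _ [s [c ->]]; exists [seq (q.1, a * q.2) | q <- s], (a * c).
    apply/funext => x; rewrite /coord_comb big_map mulrDr mulr_sumr; congr (_ + _).
    by apply: eq_bigr => q _; rewrite mulrA.
  - by move=> c; exists [::], c; apply/funext => x; rewrite /coord_comb big_nil add0r.
  - exact: seqspace_halfspaces.
have mwF d (Z : measurableType d) (p : Z -> seqspace I R) (w : Z -> R) f :
    measurable_fun setT p -> measurable_fun setT w ->
    measurable_fun setT f -> measurable_fun setT (fun z => (w z)%:E * f (p z))%E.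
  move=> mp mw mf; apply: emeasurable_funM; first exact/measurable_EFinP.
  exact: measurableT_comp.
move: F; apply: ge0_measurable_ind =>
  [A mA|f g mf mg f0 g0 If Ig|r f r0 mf f0 If|f_ f mf f0 nd fl If].
- have [_ _ _] := gI _ mA.
  by under eq_integral do rewrite EFinM; under [RHS]eq_integral do rewrite EFinM.
- under eq_integral do rewrite ge0_muleDr//.
  under [RHS]eq_integral do rewrite ge0_muleDr//.
  rewrite !ge0_integralD ?If ?Ig//; try (by move=> z _; rewrite mule_ge0 ?lee_fin);
    first [exact: (mwF _ _ p1 w1)|exact: (mwF _ _ p2 w2)].
- under eq_integral do rewrite muleCA.
  under [RHS]eq_integral do rewrite muleCA.
  rewrite !ge0_integralZl_EFin ?If//; try (by move=> z _; rewrite mule_ge0 ?lee_fin);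
    first [exact: (mwF _ _ p1 w1)|exact: (mwF _ _ p2 w2)].
- have cv d (Z : measurableType d) (m : {measure set Z -> \bar R})
      (p : Z -> seqspace I R) (w : Z -> R) :
      measurable_fun setT p -> measurable_fun setT w -> (forall z, 0 <= w z) ->
      (\int[m]_z ((w z)%:E * f_ n (p z)))%E @[n --> \oo] -->
      (\int[m]_z ((w z)%:E * f (p z)))%E.
    move=> mp mw w0; apply: cvg_ge0_integral.
    + by move=> n; exact: mwF.
    + by move=> n z; rewrite mule_ge0 ?lee_fin.
    + by move=> z a b ab; rewrite lee_wpmul2l ?lee_fin//; exact: nd.
    + by move=> z; apply: cvgeZl => //; exact: fl.
  have := cv _ _ m1 _ _ mp1 mw1 w1_ge0; rewrite (eq_cvg _ _ If).
  by move=> /(cvg_unique _); apply => //; exact: cv.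
Qed.

End exponential_moments.

(** * The inner product of square-integrable functions *)

Section L2_space.
Context d (T : measurableType d) (R : realType) (mu : {measure set T -> \bar R}).
Implicit Types (f h u : L2 mu) (t : T).

Definition norm2 f : R := fine (normL2 f).

Lemma normL2E f : normL2 f = (norm2 f)%:E.
Proof. by rewrite /norm2 /normL2 finite_norm_fine. Qed.

Lemma norm2_ge0 f : 0 <= norm2 f.
Proof. by rewrite fine_ge0// /normL2 Lnorm_ge0. Qed.

Lemma L2_addE f h t : (f + h) t = f t + h t.
Proof. by []. Qed.

Lemma L2_scaleE (a : R) f t : (a *: f) t = a * f t.
Proof. by []. Qed.

Lemma L2_oppE f t : (- f) t = - f t.
Proof. by []. Qed.

Lemma L2_0E t : (0 : L2 mu) t = 0.
Proof. by []. Qed.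

Lemma L2_sumE (J : Type) (s : seq J) (F : J -> L2 mu) t :
  (\sum_(j <- s) F j) t = \sum_(j <- s) F j t.
Proof. by elim/big_rec2 : _ => // j a b _ <-. Qed.

Lemma measurable_L2 f : measurable_fun setT f.
Proof. exact: measurable_funPT. Qed.

Lemma L2M_integrable f h : mu.-integrable setT (fun t => (f t * h t)%:E).
Proof. by apply/Lfun1_integrable/Lfun2_mul_Lfun1; exact: LfunP. Qed.

Lemma dotpE f h : (dotp f h)%:E = (\int[mu]_t (f t * h t)%:E)%E.
Proof. by rewrite /dotp fineK//; exact/integrable_fin_num/L2M_integrable. Qed.

Lemma dotpC f h : dotp f h = dotp h f.
Proof. by apply: eq_Rintegral => t _; rewrite mulrC. Qed.

Lemma dotpDl f h u : dotp (f + h) u = dotp f u + dotp h u.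
Proof.
apply: EFin_inj; rewrite [RHS]EFinD !dotpE -integralD_EFin//; try exact: L2M_integrable.
by apply: eq_integral => t _; rewrite L2_addE mulrDl.
Qed.

Lemma dotpZl a f h : dotp (a *: f) h = a * dotp f h.
Proof.
apply: EFin_inj; rewrite [RHS]EFinM !dotpE -integralZl//; last exact: L2M_integrable.
by apply: eq_integral => t _; rewrite L2_scaleE -mulrA EFinM.
Qed.

Lemma dotpDr f h u : dotp u (f + h) = dotp u f + dotp u h.
Proof. by rewrite !(dotpC u) dotpDl. Qed.

Lemma dotpZr a f h : dotp h (a *: f) = a * dotp h f.
Proof. by rewrite !(dotpC h) dotpZl. Qed.

Lemma dotp_suml (J : Type) (s : seq J) (a : J -> R) (F : J -> L2 mu) u :
  dotp (\sum_(j <- s) a j *: F j) u = \sum_(j <- s) a j * dotp (F j) u.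
Proof.
elim: s => [|j s ih]; last by rewrite !big_cons dotpDl dotpZl ih.
by rewrite !big_nil -(scale0r (0 : L2 mu)) dotpZl mul0r.
Qed.

Lemma norm2_sqr f : norm2 f ^+ 2 = dotp f f.
Proof.
have e : ((norm2 f) `^ 2)%:E = (\int[mu]_t (`|(EFin \o f) t| `^ 2))%E.
  by rewrite -powR_Lnorm// -poweR_EFin -normL2E.
apply: EFin_inj; rewrite dotpE -powR_mulrn ?norm2_ge0// e.
apply: eq_integral => t _.
by rewrite /= powR_mulrn// -normrX ger0_norm ?sqr_ge0// expr2.
Qed.

Lemma cauchy_schwarz f h : `|dotp f h| <= norm2 f * norm2 h.
Proof.
rewrite -lee_fin EFinM -!normL2E.
apply: (@le_trans _ _ ('N[mu]_1[EFin \o (f \* h)%R])%E); last first.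
  by apply: hoelder => //; rewrite [RHS]splitr !div1r.
rewrite Lnorm1 -abse_EFin dotpE; apply: le_abse_integral => //.
exact/measurable_int/L2M_integrable.
Qed.

Lemma norm2D f h : norm2 (f + h) <= norm2 f + norm2 h.
Proof. exact: ler_LnormD. Qed.

Lemma norm2Z a f : norm2 (a *: f) = `|a| * norm2 f.
Proof.
apply/eqP; rewrite -(@eqrXn2 _ 2)// ?norm2_ge0 ?mulr_ge0 ?norm2_ge0//.
by rewrite exprMn !norm2_sqr dotpZl dotpZr mulrA -normrX ger0_norm ?sqr_ge0// expr2.
Qed.

Lemma norm2B f h : norm2 (f - h) = norm2 (h - f).
Proof. by rewrite -opprB -scaleN1r norm2Z normrN1 mul1r. Qed.

Lemma ae_eq_norm2 f h : (\forall t \ae mu, f t = h t) -> norm2 f = norm2 h.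
Proof.
move=> fh; apply/eqP; rewrite -(@eqrXn2 _ 2)// ?norm2_ge0// !norm2_sqr; apply/eqP.
apply: EFin_inj; rewrite !dotpE; apply: ae_eq_integral => //.
- exact/measurable_int/L2M_integrable.
- exact/measurable_int/L2M_integrable.
- by apply: filterS fh => t /= ->.
Qed.

Lemma norm2_subadd f h u : norm2 (f - u) <= norm2 (f - h) + norm2 (h - u).
Proof. by rewrite (le_trans _ (norm2D _ _))// addrA subrK. Qed.

Lemma norm2_dist f h : `|norm2 f - norm2 h| <= norm2 (f - h).
Proof.
have := norm2D (f - h) h; have := norm2D (h - f) f.
rewrite !subrK norm2B ler_norml; lra.
Qed.

Lemma norm2_cvg f (f_ : nat -> L2 mu) :
  norm2 (f - f_ n) @[n --> \oo] --> (0 : R) -> norm2 (f_ n) @[n --> \oo] --> norm2 f.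
Proof.
move=> h; apply/cvgrPdist_le => e e0; near=> n.
apply: (le_trans (norm2_dist _ _)).
near: n; move/cvgrPdist_le : h => /(_ _ e0); apply: filterS => n.
by rewrite sub0r normrN ger0_norm ?norm2_ge0.
Unshelve. all: by end_near. Qed.

End L2_space.

(** Summable distances: the sum of the errors has a finite integral, so it is
    finite almost everywhere and its terms tend to [0]. *)
Lemma L2_fast_cvg_ae d (T : measurableType d) (R : realType)
    (mu : {finite_measure set T -> \bar R}) (f : L2 mu) (f_ : nat -> L2 mu) :
  (forall n, norm2 (f - f_ n) <= 2^-1 ^+ n) ->
  \forall t \ae mu, f_ n t @[n --> \oo] --> f t.
Proof.
move=> ff.
pose D n t := (`|f t - f_ n t|%:E)%E.
have mD n : measurable_fun setT (D n).
  apply/measurable_EFinP/measurableT_comp => //.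
  by apply: measurable_funB; exact: measurable_L2.
have D0 n t : (0 <= D n t)%E by rewrite lee_fin.
pose K := fine (Lnorm mu 2%:E (EFin \o (cst 1 : T -> R))).
have KE : Lnorm mu 2%:E (EFin \o (cst 1 : T -> R)) = K%:E.
  by rewrite /K fineK// -[EFin \o _]/(cst 1%E) Lnorm_cst1 fin_num_poweR// fin_num_measure.
have K0 : 0 <= K by rewrite fine_ge0// Lnorm_ge0.
have iD n : (\int[mu]_t D n t <= (K * 2^-1 ^+ n)%:E)%E.
  pose u : L2 mu := f - f_ n.
  have : ('N[mu]_1[EFin \o (u \* cst 1)%R] <=
      Lnorm mu 2%:E (EFin \o u) * Lnorm mu 2%:E (EFin \o (cst 1%R : T -> R)))%E.
    by apply: hoelder => //; rewrite [RHS]splitr !div1r.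
  rewrite Lnorm1 KE -[X in (X * _)%E]/(normL2 u) normL2E -EFinM => h.
  apply: (@le_trans _ _ (norm2 u * K)%:E); last first.
    by rewrite lee_fin mulrC ler_wpM2l//; exact: ff.
  apply: le_trans h; rewrite le_eqVlt; apply/orP; left; apply/eqP.
  by apply: eq_integral => t _; rewrite /= mulr1.
have iS : (\int[mu]_t (\sum_(n <oo) D n t) < +oo)%E.
  rewrite integral_nneseries//.
  apply: (@le_lt_trans _ _ (\sum_(n <oo) (K * 2^-1 ^+ n)%:E)%E).
    by apply: lee_nneseries => // n _ _; exact: integral_ge0.
  have := @cvg_geometric_eseries_half R (K * 2) 0.
  move=> /(cvg_lim (@ereal_hausdorff _)); rewrite expr0 divr1.
  rewrite (_ : (fun k => _) = (fun n => (K * 2^-1 ^+ n)%:E)) => [->|]; first exact: ltry.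
  apply/funext => n; rewrite addn1 natrX exprS invfM exprVn; congr _%:E.
  by rewrite mulrA mulfK.
have mS : measurable_fun setT (fun t => \sum_(n <oo) D n t)%E.
  by apply: ge0_emeasurable_sum.
have /(integrable_ae measurableT) : mu.-integrable setT (fun t => \sum_(n <oo) D n t)%E.
  apply/integrableP; split => //.
  by under eq_integral do rewrite gee0_abs ?nneseries_ge0//.
apply: filterS => t /(_ I) St.
have Slt : (\sum_(n <oo) D n t < +oo)%E by rewrite ltey_eq St.
have tail := nneseries_tail_cvg Slt (fun k _ => D0 k t).
have Dcvg : D n t @[n --> \oo] --> (0 : \bar R)%E.
  apply: (squeeze_cvge _ (cvg_cst 0%E) tail); apply: nearW => n; rewrite D0/=.
  apply: le_trans (@nneseries_lim_ge _ (D ^~ t) xpredT n n.+1 _) => //.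
  by rewrite big_nat1.
have {Dcvg}/fine_cvgP[_ Dcvg] := Dcvg.
apply/cvgrPdist_lt => e e0.
by move/cvgr0_norm_lt : Dcvg => /(_ _ e0); apply: filterS => n; rewrite /= normr_id.
Qed.

(** * Exponential moments of Gaussian variables *)

Lemma normal_mgf (R : realType) (m : {measure set (measurableTypeR R) -> \bar R})
    (s a : R) :
  s != 0 -> (forall B, measurable B -> m B = normal_prob 0 s B) ->
  (\int[m]_x (expR (a * x))%:E = (expR (a ^+ 2 * s ^+ 2 / 2))%:E)%E.
Proof.
move=> s0 ms.
have mE : measurable_fun setT (fun x : measurableTypeR R => (expR (a * x))%:E).
  by apply/measurable_EFinP; apply: measurableT_comp => //; exact: mulrl_measurable.
rewrite (@integral_density _ (measurableTypeR R) R lebesgue_measure m (normal_pdf 0 s))//.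
- transitivity (\int[lebesgue_measure]_x
    ((expR (a ^+ 2 * s ^+ 2 / 2))%:E * (normal_pdf (a * s ^+ 2) s x)%:E))%E.
    apply: eq_integral => x _; rewrite -!EFinM !normal_pdfE//; congr _%:E.
    rewrite mulrCA [RHS]mulrCA; congr (_ * _).
    rewrite /normal_fun -!expRD; congr expR; by field.
  rewrite ge0_integralZl_EFin ?expR_ge0//.
  + by rewrite integral_normal_pdf mule1.
  + by move=> x _; rewrite lee_fin normal_pdf_ge0.
  + by apply/measurable_EFinP; exact: measurable_normal_pdf.
- exact: measurable_normal_pdf.
- by move=> x; exact: normal_pdf_ge0.
Qed.

Section gaussian_variable.
Context d (Omega : measurableType d) (R : realType) (P : probability Omega R).

Lemma prob_integral_cst (r : \bar R) : (\int[P]_w r = r)%E.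
Proof.
rewrite integral_cst// -[RHS]mule1; congr (_ * _)%E; exact: probability_setT.
Qed.

Lemma measurable_expRM (Y : L2 P) (a : R) :
  measurable_fun setT (fun w => expR (a * Y w)).
Proof.
by apply: measurableT_comp => //; apply: measurable_funM => //.
Qed.

Lemma scaled_mgf_normal (Y : L2 P) (s : R) : s != 0 ->
  (forall B, measurable B -> P (Y @^-1` B) = normal_prob 0 s B) ->
  forall a, (\int[P]_w (expR (a * Y w))%:E = (expR (a ^+ 2 * s ^+ 2 / 2))%:E)%E.
Proof.
move=> s0 Ys a.
pose Y' : Omega -> measurableTypeR R := Y.
have mY : measurable_fun setT Y' by exact: measurable_L2.
pose Ym : {mfun Omega >-> measurableTypeR R} :=
  HB.pack Y' (isMeasurableFun.Build _ _ Omega (measurableTypeR R) Y' mY).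
rewrite -(@normal_mgf _ (pushforward P Ym) s a s0)//.
rewrite (ge0_integral_pushforward mY)//.
by apply/measurable_EFinP; apply: measurableT_comp => //; exact: mulrl_measurable.
Qed.

Lemma cvg_sqrnat_expRB1 (c : R) :
  n.+1%:R ^+ 2 * (expR (c / n.+1%:R ^+ 2) - 1) @[n --> \oo] --> c.
Proof.
have h := @cvg_natexpRB1 R c.
have k : (fun n => (n.+1 ^ 2).-1) @ \oo --> \oo.
  apply/cvgnyPge => N; near=> n.
  have : (N <= n)%N by near: n; exact: nbhs_infty_ge.
  move=> Nn; rewrite -ltnS prednK ?expn_gt0//; apply: (@leq_ltn_trans n) => //.
  by rewrite -mulnn leq_pmulr.
have := cvg_comp _ _ k h.
apply: cvg_trans; apply: near_eq_cvg; near=> n.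
by rewrite /comp prednK ?expn_gt0// natrX.
Unshelve. all: by end_near. Qed.

(** The second moment is the limit of the second moments of the difference
    quotients of the exponential. *)
Lemma mgf_second_moment (Y : L2 P) (v : R) :
  (forall a, \int[P]_w (expR (a * Y w))%:E = (expR (a ^+ 2 * v / 2))%:E)%E ->
  dotp Y Y = v.
Proof.
move=> Ymgf.
have iE a : P.-integrable setT (fun w => (expR (a * Y w))%:E).
  apply/integrableP; split; first exact/measurable_EFinP/measurable_expRM.
  by under eq_integral do rewrite gee0_abs ?lee_fin ?expR_ge0//; rewrite Ymgf ltry.
pose u n w := n.+1%:R * (expR (Y w / n.+1%:R) - 1).
have uE n w : u n w ^+ 2 = n.+1%:R ^+ 2 * expR (2 / n.+1%:R * Y w) +
    (- (2 * n.+1%:R ^+ 2) * expR (n.+1%:R^-1 * Y w) + n.+1%:R ^+ 2).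
  have -> : 2 / n.+1%:R * Y w = Y w / n.+1%:R + Y w / n.+1%:R by ring.
  rewrite expRD /u [n.+1%:R^-1 * _]mulrC; ring.
have uEe n w : (u n w ^+ 2)%:E = ((n.+1%:R ^+ 2)%:E * (expR (2 / n.+1%:R * Y w))%:E +
    ((- (2 * n.+1%:R ^+ 2))%:E * (expR (n.+1%:R^-1 * Y w))%:E + (n.+1%:R ^+ 2)%:E))%E.
  by rewrite uE.
have Iu n : (\int[P]_w (u n w ^+ 2)%:E)%E =
    (n.+1%:R ^+ 2 * (expR (2 * v / n.+1%:R ^+ 2) - 1) -
     2 * (n.+1%:R ^+ 2 * (expR (v / 2 / n.+1%:R ^+ 2) - 1)))%:E.
  under eq_integral do rewrite uEe.
  have i3 : P.-integrable setT (fun=> (n.+1%:R ^+ 2)%:E : \bar R).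
    exact: finite_measure_integrable_cst.
  have i2 : P.-integrable setT (fun w => (- (2 * n.+1%:R ^+ 2))%:E *
      (expR (n.+1%:R^-1 * Y w))%:E)%E by exact: integrableZl.
  rewrite integralD//; [|exact: integrableZl|exact: integrableD].
  rewrite integralD// !integralZl// !Ymgf prob_integral_cst.
  rewrite -!EFinM -!EFinD; congr _%:E.
  have n0 : n.+1%:R != 0 :> R by [].
  have -> : (2 / n.+1%:R) ^+ 2 * v / 2 = 2 * v / n.+1%:R ^+ 2.
    by move: n0; set k := n.+1%:R => n0; field.
  have -> : n.+1%:R^-1 ^+ 2 * v / 2 = v / 2 / n.+1%:R ^+ 2.
    by move: n0; set k := n.+1%:R => n0; field.
  ring.
have c1 : (\int[P]_w (u n w ^+ 2)%:E)%E @[n --> \oo] --> (2 * v - 2 * (v / 2))%:E.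
  under eq_cvg do rewrite Iu.
  apply: cvg_EFin; first exact: nearW.
  apply: cvgB; first exact: cvg_sqrnat_expRB1.
  by apply: cvgMl_tmp; exact: cvg_sqrnat_expRB1.
pose D w := (2 * (expR (3 * Y w) + expR (-3 * Y w)))%:E.
have iD : P.-integrable setT D.
  have -> : D = (fun w => 2%:E * ((expR (3 * Y w))%:E + (expR (-3 * Y w))%:E))%E by [].
  by apply: integrableZl => //; exact: integrableD.
have mu n : measurable_fun setT (fun w => (u n w ^+ 2)%:E).
  apply/measurable_EFinP/measurable_funX; apply: measurable_funM => //.
  apply: measurable_funB => //; under eq_fun do rewrite mulrC.
  exact: measurable_expRM.
have [||_ _] := @dominated_convergence _ Omega R P setT measurableT
  (fun n w => (u n w ^+ 2)%:E) (fun w => (Y w * Y w)%:E) D mu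
  (measurable_int _ (L2M_integrable Y Y)) _ iD _.
- apply: aeW => w _; apply: cvg_EFin; first exact: nearW.
  by apply: (@cvgM _ _ _ _ (fun n => u n w) (fun n => u n w)); exact: cvg_natexpRB1.
- apply: aeW => w n _; rewrite /= lee_fin ger0_norm ?sqr_ge0//.
  rewrite -real_normK ?num_real//.
  apply: (@le_trans _ _ ((`|Y w| * expR `|Y w|) ^+ 2)).
    by rewrite lerXn2r ?nnegrE ?mulr_ge0 ?expR_ge0//; exact: norm_natexpRB1_le.
  have h2 := exp_ge_monomial 2 (Y w).
  have h3 := expR_norm_le (3 * Y w).
  rewrite normrM ger0_norm// in h3.
  rewrite mulNr; apply: (@le_trans _ _ (2 * expR (3 * `|Y w|))); last by rewrite ler_wpM2l.
  have -> : 3 * `|Y w| = `|Y w| + (`|Y w| + `|Y w|) by ring.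
  rewrite !expRD exprMn; have := ler_wpM2r (sqr_ge0 (expR `|Y w|)) h2.
  move=> /le_trans; apply; rewrite (_ : 2`! = 2)%N// le_eqVlt; apply/orP; left; apply/eqP; ring.
rewrite -dotpE => c2.
have e : (dotp Y Y)%:E = (2 * v - 2 * (v / 2))%:E.
  exact: (cvg_unique (@ereal_hausdorff R) c2 c1).
by rewrite (EFin_inj e); field.
Qed.

Lemma gaussian_mgf (Y : L2 P) : centered_gaussian P Y ->
  (\int[P]_w (expR (Y w))%:E = (expR (dotp Y Y / 2))%:E)%E.
Proof.
move=> [Y0|[s s0 Ys]].
  have -> : dotp Y Y = 0.
    apply: EFin_inj; rewrite dotpE -[RHS](prob_integral_cst 0%E).
    apply: ae_eq_integral => //; first exact/measurable_int/L2M_integrable.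
    by apply: filterS Y0 => w /= ->; rewrite mulr0.
  rewrite mul0r expR0 -[RHS](prob_integral_cst 1%E); apply: ae_eq_integral => //.
    by apply/measurable_EFinP; apply: measurableT_comp => //; exact: measurable_L2.
  by apply: filterS Y0 => w /= -> _; rewrite expR0.
have h := scaled_mgf_normal (lt0r_neq0 s0) Ys.
rewrite (mgf_second_moment h); have := h 1.
by rewrite expr1n mul1r; under eq_integral do rewrite mul1r.
Qed.

End gaussian_variable.

(** * Gaussian spaces and the Cameron-Martin formula *)

Lemma fatou_ae d (T : measurableType d) (R : realType)
    (m : {measure set T -> \bar R}) (f_ : nat -> T -> R) (f : T -> R)
    (c_ : nat -> R) (c : R) :
  (forall n, measurable_fun setT (f_ n)) -> measurable_fun setT f ->
  (forall n x, 0 <= f_ n x) -> (forall x, 0 <= f x) ->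
  (\forall x \ae m, f_ n x @[n --> \oo] --> f x) ->
  (forall n, \int[m]_x (f_ n x)%:E = (c_ n)%:E)%E ->
  c_ n @[n --> \oo] --> c ->
  (\int[m]_x (f x)%:E <= c%:E)%E.
Proof.
move=> mf_ mf f_0 f0 ff If cc.
have mE n : measurable_fun setT (fun x => (f_ n x)%:E) by exact/measurable_EFinP.
have limE (u : nat -> R) (l : R) : u n @[n --> \oo] --> l ->
    limn_einf (fun n => (u n)%:E) = l%:E.
  move=> ul; have h : (u n)%:E @[n --> \oo] --> l%:E.
    by apply: cvg_EFin => //; exact: nearW.
  by rewrite is_cvg_limn_einfE; [exact/cvg_lim|apply/cvg_ex; exists l%:E].
have -> : (\int[m]_x (f x)%:E = \int[m]_x limn_einf (fun n => (f_ n x)%:E))%E.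
  apply: ae_eq_integral => //; first exact/measurable_EFinP.
    apply: measurableT_comp => //.
    by apply: measurable_fun_limn_esup => n; exact: measurableT_comp.
  by apply: filterS ff => x /limE -> _.
apply: le_trans (fatou m measurableT mE _) _; first by move=> n x _; rewrite lee_fin.
by under eq_fun do rewrite If; rewrite (limE _ _ cc).
Qed.

Section gaussian_space.
Context d d' (T : measurableType d) (Omega : measurableType d') (R : realType).
Variables (nu : {finite_measure set T -> \bar R}) (P : probability Omega R).
Variable X : L2 nu -> L2 P.
Hypothesis hX : gaussian_field X.

Lemma field_sum (J : Type) (s : seq J) (a : J -> R) (F : J -> L2 nu) :
  \forall w \ae P, X (\sum_(j <- s) a j *: F j) w =
    (\sum_(j <- s) a j *: X (F j)) w.
Proof.
have [lin _ _] := hX.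
elim: s => [|j s ih].
  rewrite !big_nil; have := lin 1 0 0; rewrite scaler0 addr0.
  apply: filterS => w /=; rewrite mul1r => h.
  by apply: (addrI (X 0 w)); rewrite -h; exact: (esym (addr0 (X 0 w))).
rewrite !big_cons; apply: filterS2 ih (lin (a j) (F j) (\sum_(i <- s) a i *: F i)) => w ihw ->.
by rewrite ihw.
Qed.

Lemma field_bounded : exists2 c : R, 0 <= c & forall f, norm2 (X f) <= c * norm2 f.
Proof.
have [_ [c hc] _] := hX; exists `|c| => // f.
have := hc f; rewrite !normL2E -EFinM lee_fin => /le_trans; apply.
by rewrite ler_wpM2r ?norm2_ge0 ?ler_norm.
Qed.

(** The [L^2] closure of the range of [X]. *)
Definition gaussian_limit (z : L2 P) :=
  forall e : R, 0 < e -> exists f, norm2 (z - X f) < e.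

(** [X] is linear almost surely, so combinations of its values are again values,
    up to a negligible set. *)
Lemma closed_span_gaussian_limit z : closed_span (range X) z -> gaussian_limit z.
Proof.
move=> hz e e0; have [n [a [v [hv]]]] := hz e e0.
have [f fv] : exists f, forall i, v i = X (f i).
  have /choice[f hf] : forall i, exists h, v i = X h.
    by move=> i; have [h _ <-] := hv i; exists h.
  by exists f.
rewrite normL2E lte_fin => h.
exists (\sum_i a i *: f i); rewrite (_ : norm2 _ = norm2 (z - \sum_i a i *: v i))//.
apply: ae_eq_norm2; apply: filterS (field_sum (index_enum _) a f) => w hw.
rewrite !L2_addE !L2_oppE hw; congr (_ - _).
by rewrite !L2_sumE; apply: eq_bigr => i _; rewrite fv.
Qed.

Lemma gaussian_limitD y z : gaussian_limit y -> gaussian_limit z ->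
  gaussian_limit (y + z).
Proof.
have [lin _ _] := hX.
move=> hy hz e e0; have e20 : 0 < e / 2 by rewrite divr_gt0.
have [f hf] := hy _ e20; have [h hh] := hz _ e20.
exists (1 *: f + h).
rewrite (_ : norm2 _ = norm2 ((y - X f) + (z - X h))); last first.
  apply: ae_eq_norm2; apply: filterS (lin 1 f h) => w hw.
  by rewrite !L2_addE !L2_oppE hw; ring.
by apply: le_lt_trans (norm2D _ _) _; rewrite [e]splitr ltrD.
Qed.

Lemma gaussian_limit_approx z : gaussian_limit z ->
  exists f_ : nat -> L2 nu, forall n, norm2 (z - X (f_ n)) <= 2^-1 ^+ n.
Proof.
move=> hz; have /choice[f hf] : forall n : nat, exists f, norm2 (z - X f) < 2^-1 ^+ n.
  by move=> n; apply: hz; rewrite exprn_gt0.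
by exists f => n; exact/ltW.
Qed.

Lemma cvg_half_exp : (2^-1 : R) ^+ n @[n --> \oo] --> (0 : R).
Proof.
have := @cvg_geometric R 1 2^-1; rewrite ger0_norm// => /(_ _).
rewrite (_ : geometric _ _ = (fun n => 2^-1 ^+ n)); last first.
  by apply/funext => n; rewrite /= mul1r.
by apply; rewrite invf_lt1// ltr1n.
Qed.

Lemma norm2_cvg_half z (f_ : nat -> L2 P) :
  (forall n, norm2 (z - f_ n) <= 2^-1 ^+ n) -> norm2 (z - f_ n) @[n --> \oo] --> (0 : R).
Proof.
move=> h; apply: (squeeze_cvgr _ (cvg_cst 0) cvg_half_exp).
by apply: nearW => n; rewrite norm2_ge0 h.
Qed.

(** [L^2] limits of Gaussian variables keep the Gaussian exponential moment.
    Fatou's lemma gives one inequality directly, and the other one when it is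
    applied to the nonnegative functions [e exp (2 y) - exp y + 1 / (4 e)]. *)
Lemma gaussian_limit_mgf z : gaussian_limit z ->
  (\int[P]_w (expR (z w))%:E = (expR (dotp z z / 2))%:E)%E.
Proof.
have [lin _ gX] := hX.
have Xmgf f a : (\int[P]_w (expR (a * X f w))%:E =
    (expR (a ^+ 2 * norm2 (X f) ^+ 2 / 2))%:E)%E.
  have X0 := field_sum [::] (fun=> 0) (fun _ : nat => 0 : L2 nu).
  rewrite !big_nil in X0.
  have e : \forall w \ae P, X (a *: f + 0) w = (a *: X f) w.
    apply: filterS2 X0 (lin a f 0) => w hw ->.
    by rewrite hw L2_0E L2_scaleE addr0.
  transitivity (\int[P]_w (expR (X (a *: f + 0) w))%:E)%E.
    apply: ae_eq_integral => //.
    - exact/measurable_EFinP/measurable_expRM.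
    - by apply/measurable_EFinP; apply: measurableT_comp.
    - by apply: filterS e => w -> _; rewrite L2_scaleE.
  rewrite gaussian_mgf; last exact: gX.
  rewrite -norm2_sqr (ae_eq_norm2 e) norm2Z exprMn -normrX ger0_norm ?sqr_ge0//.
move=> hz; have [f_ hf] := gaussian_limit_approx hz.
have aecv : \forall w \ae P, X (f_ n) w @[n --> \oo] --> z w.
  exact: (@L2_fast_cvg_ae _ _ _ P z (fun n => X (f_ n))).
have ncv : norm2 (X (f_ n)) @[n --> \oo] --> norm2 z.
  exact/norm2_cvg/norm2_cvg_half.
have n2cv a : expR (a ^+ 2 * norm2 (X (f_ n)) ^+ 2 / 2) @[n --> \oo] -->
    expR (a ^+ 2 * norm2 z ^+ 2 / 2).
  have h : a ^+ 2 * norm2 (X (f_ n)) ^+ 2 / 2 @[n --> \oo] --> a ^+ 2 * norm2 z ^+ 2 / 2.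
    apply: cvgMr_tmp; apply: cvgMl_tmp.
    exact: (@cvgM _ _ _ _ (fun n => norm2 (X (f_ n))) (fun n => norm2 (X (f_ n)))).
  exact: (cvg_comp _ _ h (@continuous_expR R _)).
have expcv a (u : nat -> R) l : u n @[n --> \oo] --> l ->
    expR (a * u n) @[n --> \oo] --> expR (a * l).
  move=> ul; have h : a * u n @[n --> \oo] --> a * l by exact: cvgMl_tmp.
  exact: (cvg_comp _ _ h (@continuous_expR R _)).
have mE (y : L2 P) a : measurable_fun setT (fun w => expR (a * y w)).
  exact: measurable_expRM.
have ub a : (\int[P]_w (expR (a * z w))%:E <= (expR (a ^+ 2 * norm2 z ^+ 2 / 2))%:E)%E.
  apply: (@fatou_ae _ _ _ _ (fun n w => expR (a * X (f_ n) w)) _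
     (fun n => expR (a ^+ 2 * norm2 (X (f_ n)) ^+ 2 / 2))) => //.
  by apply: filterS aecv => w; exact: expcv.
have iE a : P.-integrable setT (fun w => (expR (a * z w))%:E).
  apply/integrableP; split; first exact/measurable_EFinP.
  under eq_integral do rewrite gee0_abs ?lee_fin ?expR_ge0//.
  by apply: le_lt_trans (ub a) _; rewrite ltry.
have iXE f a : P.-integrable setT (fun w => (expR (a * X f w))%:E).
  apply/integrableP; split; first exact/measurable_EFinP.
  by under eq_integral do rewrite gee0_abs ?lee_fin ?expR_ge0//; rewrite Xmgf ltry.
have Iz a : exists2 r : R, (\int[P]_w (expR (a * z w))%:E = r%:E)%E & 0 <= r.
  exists (fine (\int[P]_w (expR (a * z w))%:E)).
    by rewrite fineK//; exact: integrable_fin_num.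
  by apply: fine_ge0; apply: integral_ge0 => w _; rewrite lee_fin expR_ge0.
have [r1 Ir1 r10] := Iz 1; have [r2 Ir2 r20] := Iz 2.
pose q e (y : R) := e * expR (2 * y) + ((-1) * expR (1 * y) + (4 * e)^-1).
have qE e (y : L2 P) r r' : P.-integrable setT (fun w => (expR (2 * y w))%:E) ->
    P.-integrable setT (fun w => (expR (1 * y w))%:E) ->
    (\int[P]_w (expR (2 * y w))%:E = r%:E)%E ->
    (\int[P]_w (expR (1 * y w))%:E = r'%:E)%E ->
    (\int[P]_w (q e (y w))%:E = (e * r + ((-1) * r' + (4 * e)^-1))%:E)%E.
  move=> i2 i1 I2 I1.
  have i3 : P.-integrable setT (fun=> ((4 * e)^-1)%:E : \bar R).
    exact: finite_measure_integrable_cst.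
  have i4 : P.-integrable setT (fun w => (-1)%:E * (expR (1 * y w))%:E)%E.
    exact: integrableZl.
  transitivity (\int[P]_w (e%:E * (expR (2 * y w))%:E +
      ((-1)%:E * (expR (1 * y w))%:E + ((4 * e)^-1)%:E)))%E => //.
  rewrite integralD//; [|exact: integrableZl|exact: integrableD].
  by rewrite integralD// !integralZl// I2 I1 prob_integral_cst.
have q0 e y : 0 < e -> 0 <= q e y.
  move=> e0; rewrite /q mul1r mulN1r.
  have -> : expR (2 * y) = expR y ^+ 2 by rewrite expr2 -expRD; congr expR; ring.
  have -> : e * expR y ^+ 2 + (- expR y + (4 * e)^-1) = e * (expR y - (2 * e)^-1) ^+ 2.
    by field; rewrite gt_eqF.
  by rewrite mulr_ge0 ?sqr_ge0// ltW.
(* the lower bound holds up to an error that vanishes with [e] *)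
have lb e : 0 < e -> expR (norm2 z ^+ 2 / 2) - e * expR (2 * norm2 z ^+ 2) <= r1.
  move=> e0.
  have := @fatou_ae _ _ _ P (fun n w => q e (X (f_ n) w)) (fun w => q e (z w))
    (fun n => e * expR (2 ^+ 2 * norm2 (X (f_ n)) ^+ 2 / 2) +
       ((-1) * expR (1 ^+ 2 * norm2 (X (f_ n)) ^+ 2 / 2) + (4 * e)^-1))
    (e * expR (2 ^+ 2 * norm2 z ^+ 2 / 2) +
       ((-1) * expR (1 ^+ 2 * norm2 z ^+ 2 / 2) + (4 * e)^-1)).
  have mq (y : L2 P) : measurable_fun setT (fun w => q e (y w)).
    apply: measurable_funD; first exact: measurable_funM.
    by apply: measurable_funD => //; exact: measurable_funM.
  move=> /(_ (fun n => mq _) (mq _) (fun n x => q0 _ _ e0) (fun x => q0 _ _ e0)).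
  rewrite (qE _ _ _ _ (iE 2) (iE 1) Ir2 Ir1) lee_fin => H.
  have {H} : e * r2 + (-1 * r1 + (4 * e)^-1) <=
      e * expR (2 ^+ 2 * norm2 z ^+ 2 / 2) +
      (-1 * expR (1 ^+ 2 * norm2 z ^+ 2 / 2) + (4 * e)^-1).
    apply: H.
    - apply: filterS aecv => w hw; rewrite /q.
      apply: cvgD; first by apply: cvgMl_tmp; exact: expcv.
      by apply: cvgD; [apply: cvgMl_tmp; exact: expcv|exact: cvg_cst].
    - by move=> n; rewrite (qE _ _ _ _ (iXE _ 2) (iXE _ 1) (Xmgf _ _) (Xmgf _ _)).
    - apply: cvgD; first by apply: cvgMl_tmp.
      by apply: cvgD; [exact: cvgMl_tmp|exact: cvg_cst].
  have -> : 2 ^+ 2 * norm2 z ^+ 2 / 2 = 2 * norm2 z ^+ 2 by field.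
  rewrite expr1n mul1r => H.
  have : 0 <= e * r2 by rewrite mulr_ge0// ltW.
  lra.
under eq_integral do rewrite -[z _]mul1r.
have := ub 1; rewrite Ir1 lee_fin expr1n mul1r -norm2_sqr => ub1.
congr _%:E; apply/eqP; rewrite eq_le ub1/=.
apply/ler_addgt0Pl => e e0.
have E0 := expR_gt0 (2 * norm2 z ^+ 2).
have := lb (e / expR (2 * norm2 z ^+ 2)) (divr_gt0 e0 E0).
by rewrite divfK ?gt_eqF// lerBlDl.
Qed.

End gaussian_space.

Section cameron_martin_formula.
Context d d' (T : measurableType d) (Omega : measurableType d') (R : realType).
Variables (nu : {finite_measure set T -> \bar R}) (P : probability Omega R).
Variable X : L2 nu -> L2 P.
Hypothesis hX : gaussian_field X.
Variables (I : countType) (g : I -> L2 nu).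

Definition field_comb (s : seq (I * R)) : L2 P := \sum_(q <- s) q.2 *: X (g q.1).

Lemma coord_comb_field s w : coord_comb s (field_coord g X w) = field_comb s w.
Proof. by rewrite /field_comb L2_sumE. Qed.

Lemma coord_combD s (x y : seqspace I R) :
  coord_comb s (fun i => x i + y i) = coord_comb s x + coord_comb s y.
Proof.
by rewrite /coord_comb -big_split; apply: eq_bigr => q _; rewrite mulrDr.
Qed.

Lemma measurable_field_coord : measurable_fun setT (field_coord g X).
Proof. by apply: measurable_to_seqspace => i; exact: measurable_L2. Qed.

Lemma field_comb_limit s : gaussian_limit X (field_comb s).
Proof.
move=> e e0; exists (\sum_(q <- s) q.2 *: g q.1).
have := field_sum hX s snd (fun q => g q.1) => h.
rewrite (_ : norm2 _ = norm2 (0 : L2 P)); last first.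
  by apply: ae_eq_norm2; apply: filterS h => w hw; rewrite L2_addE L2_oppE hw subrr.
by rewrite -(scale0r (0 : L2 P)) norm2Z normr0 mul0r.
Qed.

Lemma dotp_field_comb (z : L2 P) s :
  dotp z (field_comb s) = coord_comb s (fun i => dotp z (X (g i))).
Proof.
by rewrite dotpC dotp_suml; apply: eq_bigr => q _; rewrite dotpC.
Qed.

(** Both sides are integrals against measures on sequences, so it is enough to
    compare their exponential moments, which [gaussian_limit_mgf] computes. *)
Lemma cameron_martin_formula (z : L2 P) (F : seqspace I R -> \bar R) :
  gaussian_limit X z -> measurable_fun setT F -> (forall x, (0 <= F x)%E) ->
  (\int[P]_w F (fun i => (X (g i) w + dotp z (X (g i)))%R) =
   \int[P]_w ((expR (z w - dotp z z / 2))%:E * F (field_coord g X w)))%E.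
Proof.
move=> hz mF F0.
pose p1 w : seqspace I R := fun i => X (g i) w + dotp z (X (g i)).
have mp1 : measurable_fun setT p1.
  by apply: measurable_to_seqspace => i; apply: measurable_funD => //; exact: measurable_L2.
have mw : measurable_fun setT (fun w => expR (z w - dotp z z / 2)).
  by apply: measurableT_comp => //; apply: measurable_funD => //; exact: measurable_L2.
have mexp (y : L2 P) : measurable_fun setT (fun w => (expR (y w))%:E).
  by apply/measurable_EFinP/measurableT_comp => //; exact: measurable_L2.
have e1 s : (\int[P]_w (1 * expR (coord_comb s (p1 w)))%:E =
    (expR (dotp z (field_comb s) + dotp (field_comb s) (field_comb s) / 2))%:E)%E.
  under eq_integral.
    move=> w _; rewrite mul1r coord_combD -dotp_field_comb addrC expRD EFinM.
    rewrite -[X in _ (coord_comb s X)]/(field_coord g X w) coord_comb_field; over.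
  rewrite ge0_integralZl_EFin ?expR_ge0//.
  rewrite (gaussian_limit_mgf hX (field_comb_limit s)).
  by rewrite -EFinM -expRD.
have := @exponential_moments_unique I R _ _ Omega Omega P P p1 (field_coord g X)
  (fun _ => 1) (fun w => expR (z w - dotp z z / 2)) mp1 measurable_field_coord
  (measurable_cst _) mw (fun _ => ler01) (fun _ => expR_ge0 _) _ _ F mF F0.
under eq_integral do rewrite mul1e.
apply.
  by move=> s; rewrite e1 ltry.
move=> s; rewrite e1.
have e2 w : (expR (z w - dotp z z / 2) * expR (coord_comb s (field_coord g X w)))%:E =
    ((expR (- (dotp z z / 2)))%:E * (expR ((z + field_comb s) w))%:E)%E.
  rewrite coord_comb_field L2_addE -EFinM -!expRD; congr (expR _)%:E; ring.
under [RHS]eq_integral do rewrite e2.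
rewrite ge0_integralZl_EFin ?expR_ge0//.
rewrite (gaussian_limit_mgf hX (gaussian_limitD hX hz (field_comb_limit s))).
rewrite -EFinM -expRD; congr (expR _)%:E.
by rewrite dotpDl !dotpDr (dotpC (field_comb s) z); field.
Qed.

End cameron_martin_formula.

(** * From chaos to the Girsanov formula *)

Section chaos.
Context (R : realType) (d d' : measure_display)
  (T : measurableType d) (Omega : measurableType d')
  (mu : {finite_measure set T -> \bar R}) (P : probability Omega R)
  (nu : {finite_measure set T -> \bar R})
  (X : L2 nu -> L2 P) (hX : gaussian_field X)
  (C : L2 nu -> L2 nu) (hC : covariance_operator X C)
  (I : countType) (g : I -> L2 nu)
  (M : R.-ftker Omega ~> T)
  (m : R.-ftker seqspace I R ~> T) (hm : represents g X M m).

(** [C] is linear only up to almost everywhere equality; combining its values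
    instead of its arguments keeps the identities pointwise. *)
Definition covariance_comb (s : seq (I * R)) : L2 nu :=
  \sum_(q <- s) q.2 *: C (g q.1).

Lemma coord_comb_covariance s t :
  coord_comb s (fun i => C (g i) t) = covariance_comb s t.
Proof. by rewrite /covariance_comb L2_sumE. Qed.

Lemma dotp_covariance_comb s h :
  dotp (covariance_comb s) h = dotp (field_comb X g s) (X h).
Proof. by rewrite !dotp_suml; apply: eq_bigr => q _; rewrite hC. Qed.

Lemma covariance_comb_cameron_martin s : cameron_martin X (covariance_comb s).
Proof.
exists (field_comb X g s); last by move=> h; exact: dotp_covariance_comb.
move=> e e0; pose q (i : 'I_(size s)) := tnth (in_tuple s) i.
exists (size s), (fun i => (q i).2), (fun i => X (g (q i).1)); split.
  by move=> i; exists (g (q i).1).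
have sE : field_comb X g s = \sum_i (q i).2 *: X (g (q i).1).
  by rewrite /field_comb big_tnth.
rewrite -sE subrr normL2E lte_fin -(scale0r (0 : L2 P)) norm2Z normr0 mul0r//.
Qed.

Lemma measurable_covariance_shift (e : R) : measurable_fun setT
  (fun z : Omega * T => (fun i => X (g i) z.1 + e * C (g i) z.2) : seqspace I R).
Proof.
apply: measurable_to_seqspace => i; apply: measurable_funD.
  by apply: measurableT_comp => //; exact: measurable_L2.
by apply: measurable_funM => //; apply: measurableT_comp => //; exact: measurable_L2.
Qed.

Lemma measurable_kernel_integral (h : T -> \bar R) : measurable_fun setT h ->
  (forall t, (0 <= h t)%E) -> measurable_fun setT (fun x => \int[m x]_t h t)%E.
Proof.
move=> mh h0; apply: measurable_fun_integral_kernel => // U mU.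
exact: measurable_kernel.
Qed.

Lemma represents_integral (h : T -> \bar R) :
  \forall w \ae P, (\int[M w]_t h t = \int[m (field_coord g X w)]_t h t)%E.
Proof.
apply: filterS hm => w hw; apply: eq_measure_integral => A mA _; exact: hw.
Qed.

Section forward.
Hypothesis hM : forall xi : L2 nu, cameron_martin X xi ->
  \forall w \ae P, forall A : set T, measurable A ->
    m (shift_cm g X xi w) A = (\int[M w]_(t in A) (expR (xi t))%:E)%E.
Hypothesis EM : forall A, measurable A -> mean_measure P M A = mu A.

(** The weight [exp (- xi)] cancels the factor [exp xi] which the chaos acquires
    under the Cameron-Martin shift, hence a moment that is always finite. *)
Lemma campbell_exponential_moment (A : set T) s : measurable A ->
  (\int[campbell P M]_z (\1_A z.2 * expR (coord_comb s
      (fun i => (X (g i) z.1 + (-1) * C (g i) z.2)%R)))%:E =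
   (expR (dotp (field_comb X g s) (field_comb X g s) / 2))%:E * mu A)%E.
Proof.
move=> mA; set z := field_comb X g s; set xi := covariance_comb s.
pose h t := (\1_A t * expR (- xi t))%:E.
have mxi (e : R) : measurable_fun setT (fun t => expR (e * xi t)).
  by apply: measurableT_comp => //; apply: measurable_funM => //; exact: measurable_L2.
have mh : measurable_fun setT h.
  apply/measurable_EFinP; apply: measurable_funM => //.
  by under eq_fun do rewrite -mulN1r; exact: mxi.
have h0 t : (0 <= h t)%E by rewrite lee_fin mulr_ge0// expR_ge0.
have mz : measurable_fun setT (fun w => (expR (z w))%:E).
  by apply/measurable_EFinP; apply: measurableT_comp => //; exact: measurable_L2.
have mMh : measurable_fun setT (fun w => \int[M w]_t h t)%E.
  by apply: measurable_fun_integral_kernel => // U mU; exact: measurable_kernel.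
have Mh0 w : (0 <= \int[M w]_t h t)%E by exact: integral_ge0.
pose F x := (\int[m x]_t h t)%E.
have mF : measurable_fun setT F by exact: measurable_kernel_integral.
have F0 x : (0 <= F x)%E by exact: integral_ge0.
have mfc := measurable_field_coord X g.
pose f (u : Omega * T) := ((expR (z u.1))%:E * h u.2)%E.
have mf : measurable_fun setT f.
  apply: emeasurable_funM; first exact: (measurableT_comp mz).
  exact: (measurableT_comp mh).
have f0 u : (0 <= f u)%E by rewrite mule_ge0// lee_fin expR_ge0.
transitivity (\int[campbell P M]_u f u)%E.
  apply: eq_integral => u _; rewrite /f /h -EFinM; congr _%:E.
  rewrite coord_combD coord_comb_field mulrCA; congr (_ * _).
  rewrite expRD; congr (_ * expR _).
  rewrite -coord_comb_covariance /coord_comb -sumrN; apply: eq_bigr => q _.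
  by rewrite mulN1r mulrN.
rewrite integral_campbell//.
transitivity (\int[P]_w ((expR (z w))%:E * F (field_coord g X w)))%E.
  apply: ae_eq_integral => //.
  - by apply: measurable_kfcomp.
  - by apply: emeasurable_funM => //; exact: measurableT_comp.
  - apply: filterS (represents_integral h) => w hw _.
    rewrite /f /= ge0_integralZl_EFin ?expR_ge0//; congr (_ * _)%E.
    exact: hw.
transitivity ((expR (dotp z z / 2))%:E *
    \int[P]_w ((expR (z w - dotp z z / 2))%:E * F (field_coord g X w)))%E.
  rewrite -ge0_integralZl_EFin ?expR_ge0//; last 2 first.
  - by move=> w _; rewrite mule_ge0// lee_fin expR_ge0.
  - apply: emeasurable_funM; last exact: measurableT_comp.
    apply/measurable_EFinP; apply: measurableT_comp => //.
    by apply: measurable_funB => //; exact: measurable_L2.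
  apply: eq_integral => w _; rewrite muleA -EFinM -expRD.
  by rewrite addrC subrK.
congr (_ * _)%E.
rewrite -(cameron_martin_formula hX g (field_comb_limit hX g s) mF F0).
transitivity (mean_measure P M A); last exact: EM.
apply: ae_eq_integral => //.
- apply: (measurableT_comp mF (_ : measurable_fun setT
    (fun w => (fun i => X (g i) w + dotp z (X (g i))) : seqspace I R))).
  apply: measurable_to_seqspace => i.
  by apply: measurable_funD => //; exact: measurable_L2.
- exact: measurable_kernel.
apply: filterS (hM (covariance_comb_cameron_martin s)) => w hw _.
rewrite (_ : (fun i => _) = shift_cm g X xi w); last first.
  by apply/funext => i; rewrite /shift_cm dotp_covariance_comb.
rewrite /F (@integral_density _ _ _ (M w) _ (fun t => expR (xi t)))//.
- rewrite -[RHS]mul1e -[RHS]integral_cst// [RHS]integral_mkcond.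
  apply: eq_integral => t _; rewrite /h -EFinM -mulrA -expRD addNr expR0 mulr1.
  by rewrite patchE indicE; case: (_ \in _).
by under eq_fun do rewrite -[xi _]mul1r; exact: mxi.
Qed.

(** For each [A], [campbell_exponential_moment] computes the exponential moments
    of [X - K(t, .)] restricted to [A]; they are those of [X] times [mu A]. Hence
    under the Campbell measure [X - K(t, .)] is independent of [t]. *)
Lemma campbell_decoupling (f : seqspace I R * T -> \bar R) :
  measurable_fun setT f -> (forall z, (0 <= f z)%E) ->
  (\int[campbell P M]_z
      f ((fun i => X (g i) z.1 + (-1) * C (g i) z.2)%R, z.2) =
   \int[P \x mu]_z f (field_coord g X z.1, z.2))%E.
Proof.
move=> mf f0.
pose q1 (z : Omega * T) : seqspace I R := fun i => X (g i) z.1 + (-1) * C (g i) z.2.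
pose q2 (z : Omega * T) := field_coord g X z.1.
have mq1 : measurable_fun setT q1 := @measurable_covariance_shift (-1).
have mq2 : measurable_fun setT q2.
  by apply: measurableT_comp => //; exact: measurable_field_coord.
have mp1 : measurable_fun setT (fun z => (q1 z, z.2)) by exact: measurable_fun_pair.
have mp2 : measurable_fun setT (fun z => (q2 z, z.2)) by exact: measurable_fun_pair.
pose r1 : {mfun (Omega * T)%type >-> (seqspace I R * T)%type} :=
  HB.pack (fun z => (q1 z, z.2)) (isMeasurableFun.Build _ _ _ _ _ mp1).
pose r2 : {mfun (Omega * T)%type >-> (seqspace I R * T)%type} :=
  HB.pack (fun z => (q2 z, z.2)) (isMeasurableFun.Build _ _ _ _ _ mp2).
transitivity (\int[pushforward (campbell P M) r1]_z f z)%E.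
  by rewrite ge0_integral_pushforward.
transitivity (\int[pushforward (P \x mu)%E r2]_z f z)%E; last first.
  by rewrite ge0_integral_pushforward.
apply: eq_measure_integral => D mD _.
apply: (measure_unique [set B `*` A | B in measurable & A in measurable]
  (fun _ => setT)) => //.
- exact: measurable_prod_measurableType.
- move=> _ _ [B1 mB1 [A1 mA1 <-]] [B2 mB2 [A2 mA2 <-]].
  exists (B1 `&` B2); first exact: measurableI.
  by exists (A1 `&` A2); [exact: measurableI|rewrite setXI].
- by move=> _; exists setT => //; exists setT => //; rewrite setXTT.
- by rewrite bigcup_const//; exists 0%N.
- move=> _ [B mB [A mA <-]].
  have m1 : measurable_fun setT (fun z : Omega * T => \1_A z.2 : R).
    exact: measurableT_comp.
  have := @exponential_moments_unique I R _ _ _ _ (campbell P M) (P \x mu)%E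
    q1 q2 (fun z => \1_A z.2) (fun z => \1_A z.2) mq1 mq2 m1 m1
    (fun _ => ler0n _ _) (fun _ => ler0n _ _) _ _ (fun x => (\1_B x)%:E).
  move=> H.
  have e : (\int[campbell P M]_z ((\1_A z.2)%:E * (\1_B (q1 z))%:E) =
     \int[P \x mu]_z ((\1_A z.2)%:E * (\1_B (q2 z))%:E))%E.
    apply: H.
    + move=> s; rewrite campbell_exponential_moment//.
      by rewrite lte_mul_pinfty ?lee_fin ?expR_ge0// -ge0_fin_numE ?fin_num_measure.
    + move=> s; rewrite campbell_exponential_moment//.
      have mz : measurable_fun setT (fun w => (expR (field_comb X g s w))%:E).
        by apply/measurable_EFinP; apply: measurableT_comp => //; exact: measurable_L2.
      rewrite (fubini_tonelli1 (fun z : Omega * T =>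
        (\1_A z.2 * expR (coord_comb s (q2 z)))%:E)); last 2 first.
      * apply/measurable_EFinP; apply: measurable_funM => //.
        apply: measurableT_comp => //; apply: measurableT_comp => //.
        exact: measurable_coord_comb.
      * by move=> z; rewrite lee_fin mulr_ge0// expR_ge0.
      transitivity (\int[P]_w ((expR (field_comb X g s w))%:E * mu A))%E.
        rewrite ge0_integralZr//.
        by rewrite (gaussian_limit_mgf hX (field_comb_limit hX g s)).
      apply: eq_integral => w _; rewrite /fubini_F /q2 /= coord_comb_field.
      under eq_integral do rewrite mulrC EFinM.
      rewrite ge0_integralZl_EFin ?expR_ge0//; last exact/measurable_EFinP.
      by rewrite integral_indic// setIT.
    + by apply/measurable_EFinP.
    + by move=> x; rewrite lee_fin.
  have indE (m0 : {measure set (Omega * T) -> \bar R}) q :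
      measurable_fun setT q ->
      (\int[m0]_z ((\1_A z.2)%:E * (\1_B (q z))%:E))%E =
      m0 ((fun z => (q z, z.2)) @^-1` (B `*` A)).
    move=> mq; rewrite -[X in m0 X]setIT -integral_indic//; last first.
      rewrite -[X in measurable X]setTI; apply: measurable_fun_pair => //.
      exact: measurableX.
    apply: eq_integral => z _; rewrite -EFinM !indicE; congr _%:E.
    have -> : (z \in (fun z => (q z, z.2)) @^-1` (B `*` A)) = (q z \in B) && (z.2 \in A).
      by apply/idP/andP => [/set_mem[/= ? ?]|[/set_mem ? /set_mem ?]]; rewrite ?inE.
    by case: (_ \in B); case: (_ \in A); rewrite /= ?mulr1 ?mulr0 ?mul0r.
  exact: (etrans (esym (indE _ _ mq1)) (etrans e (indE _ _ mq2))).
- move=> _; rewrite [ltLHS](_ : _ = mean_measure P M setT).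
    by rewrite EM// -ge0_fin_numE ?fin_num_measure.
  apply: eq_integral => w _; congr (M w _).
  by apply/seteqP; split => // t _; rewrite /xsection /= inE.
Qed.

(** [campbell_decoupling] applied to [(y, t) |-> f (y + K(t, .), t)]. *)
Lemma chaos_girsanov (f : seqspace I R * T -> \bar R) :
  measurable_fun setT f -> (forall z, (0 <= f z)%E) ->
  (\int[P]_w \int[M w]_t f (field_coord g X w, t) =
   \int[P]_w \int[mu]_t f (shift_cov g X C t w, t))%E.
Proof.
move=> mf f0.
have mfc := measurable_field_coord X g.
pose sh (z : seqspace I R * T) : seqspace I R := fun i => z.1 i + C (g i) z.2.
have msh : measurable_fun setT sh.
  apply: measurable_to_seqspace => i; apply: measurable_funD.
    by apply: (measurableT_comp (measurable_coord i)).
  by apply: measurableT_comp => //; exact: measurable_L2.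
pose f' (z : seqspace I R * T) := f (sh z, z.2).
have mf' : measurable_fun setT f'.
  by apply: (measurableT_comp mf); exact: measurable_fun_pair.
have f'0 z : (0 <= f' z)%E by exact: f0.
have := campbell_decoupling mf' f'0.
rewrite /f' /sh /=.
under eq_integral.
  move=> z _; rewrite (_ : (fun i => _) = field_coord g X z.1); last first.
    by apply/funext => i; rewrite mulN1r subrK.
  over.
rewrite (integral_campbell P M (f := fun z => f (field_coord g X z.1, z.2)))//; last first.
  apply: (measurableT_comp mf); apply: measurable_fun_pair => //.
  exact: measurableT_comp.
move=> ->; rewrite fubini_tonelli1//.
have mp : measurable_fun setT (fun z : Omega * T => (field_coord g X z.1, z.2)).
  by apply: measurable_fun_pair => //; exact: measurableT_comp.
exact: (measurableT_comp mf' mp).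
Qed.


End forward.
End chaos.

(** * Measures on a standard Borel space *)

(** The system consists of the finite intersections of preimages of interiors of
    balls, of radius [1 / (n + 1)] around the points of a countable dense set. *)
Lemma standard_borel_pi_system (R : realType) d (T : measurableType d) :
  standard_borel R T -> exists G : nat -> set T,
    [/\ forall n, measurable (G n), @measurable _ T = <<s range G >>,
        setI_closed (range G) & exists n, G n = setT].
Proof.
move=> [E [f [_ [D cD dD] [fi fK ifK] fm]]].
have /pcard_injP[idx idx_inj] : (D #<= [set: nat])%card by [].
(* the union has at most one term, as [idx] is injective on [D] *)
pose W (j : nat * nat) : set E := \bigcup_(x in D `&` [set x | idx x = j.1])
  (ball x (j.2.+1%:R^-1))°.
have oW j : open (W j) by apply: bigcup_open => x _; exact: open_interior.
have fimage (O : set E) : f @` (f @^-1` O) = O.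
  by apply/seteqP; split=> [_ [t Ot <-]//|y Oy]; exists (fi y); rewrite /= ifK.
have fpreimage (A : set T) : f @^-1` (f @` A) = A.
  apply/seteqP; split=> [t [s As fst]|t At]; last by exists t.
  by rewrite -(fK t) -fst fK.
pose B j := f @^-1` W j.
have mB j : measurable (B j).
  by apply/fm; rewrite fimage; apply: sub_sigma_algebra; exact: oW.
pose inter (s : seq (nat * nat)) : set T := [set t | forall j, j \in s -> B j t].
have minter s : measurable (inter s).
  elim: s => [|j s ih].
    by rewrite (_ : inter _ = setT)//; apply/seteqP; split.
  rewrite (_ : inter _ = B j `&` inter s); first exact: measurableI.
  apply/seteqP; split => [t h|t [Bt It] k].
    by split=> [|k ks]; apply: h; rewrite inE ?eqxx// ks orbT.
  by rewrite inE => /orP[/eqP->//|]; exact: It.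
pose G n := if unpickle n is Some s then inter s else setT.
have Gpickle s : G (pickle s) = inter s by rewrite /G pickleK.
have GT : range G setT.
  by exists (pickle (nil : seq (nat * nat))) => //; rewrite Gpickle; apply/seteqP; split.
have Gr n : exists s, G n = inter s.
  rewrite /G; case: unpickle => [s|]; first by exists s.
  by exists nil; apply/seteqP; split.
have mG n : measurable (G n) by have [s ->] := Gr n.
exists G; split => //; last 2 first.
- move=> _ _ [n1 _ <-] [n2 _ <-]; have [s1 ->] := Gr n1; have [s2 ->] := Gr n2.
  exists (pickle (s1 ++ s2)) => //; rewrite Gpickle; apply/seteqP; split => [t h|t [h1 h2] j].
    by split => j js; apply: h; rewrite mem_cat js ?orbT.
  by rewrite mem_cat => /orP[]; [exact: h1|exact: h2].
- by have [n _ Gn] := GT; exists n.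
apply/seteqP; split; last first.
  apply: smallest_sub; last by move=> _ [n _ <-].
  by split; [exact: measurable0|move=> A; exact: measurableD|move=> F; exact: bigcupT_measurable].
have [S0 SC SU] := smallest_sigma_algebra setT (range G).
have SB j : <<s range G >> (B j).
  apply: sub_sigma_algebra; exists (pickle [:: j]) => //; rewrite Gpickle.
  apply/seteqP; split => [t|t Bt k]; first by apply; rewrite inE.
  by rewrite inE => /eqP->.
suff h : <<s @open E >> `<=` [set O | <<s range G >> (f @^-1` O)].
  by move=> A /fm /h /=; rewrite fpreimage.
apply: smallest_sub; first split => /=.
- by rewrite preimage_set0.
- by move=> O hO; have := SC _ hO; rewrite !setTD preimage_setC.
- by move=> F hF; rewrite preimage_bigcup; exact: SU.
move=> O oO /=.
pose H n k := if `[< B (k, n) `<=` f @^-1` O >] then B (k, n) else set0.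
have -> : f @^-1` O = \bigcup_n \bigcup_k H n k.
  apply/seteqP; split => [t Ot|t [n _ [k _]]]; last first.
    by rewrite /H; case: asboolP => // BO /BO.
  have [e e0 eO] : nbhs_ball (f t) O by apply/nbhs_ballP/open_nbhs_nbhs.
  have [n ne] : exists n : nat, n.+1%:R^-1 < e / 2.
    have e20 : 0 < e / 2 by rewrite divr_gt0.
    have := cvgr0_norm_lt _ (@cvg_harmonic R) _ e20.
    move=> [N _ /(_ N (leqnn N))]; rewrite /= ger0_norm// => h.
    by exists N.
  set r : R := n.+1%:R^-1 in ne.
  have r20 : 0 < r / 2 by rewrite divr_gt0// /r invr_gt0.
  have [x [xb Dx]] : (ball (f t) (r / 2))° `&` D !=set0.
    apply: dD; last exact: open_interior.
    by exists (f t); exact: nbhsx_ballx.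
  move/interior_subset : xb => xb.
  exists n => //; exists (idx x) => //; rewrite /H; case: asboolP => [_|].
    exists x => //; apply/nbhs_ballP; exists (r / 2) => //= y yt.
    by apply: ball_split yt; exact: ball_sym.
  move=> []; move=> s [y [Dy /= yx] /interior_subset ys].
  apply: eO; have {}yx : y = x by apply: idx_inj; rewrite ?inE.
  rewrite yx in ys; apply: (@le_ball _ _ _ (r / 2 + r)); last exact: ball_triangle xb ys.
  by move: ne r20; lra.
by apply: (SU) => n; apply: (SU) => k; rewrite /H; case: asboolP => _; [exact: SB|exact: S0].
Qed.

Section density_measure.
Context d (T : measurableType d) (R : realType) (m : {measure set T -> \bar R}).
Variables (h : T -> \bar R) (mh : measurable_fun setT h) (h0 : forall t, (0 <= h t)%E).

(** The proofs of measurability and positivity are arguments because the measure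
    instance is inferred from them. *)
Definition density_measure of measurable_fun setT h & (forall t, (0 <= h t)%E) :=
  fun A : set T => (\int[m]_(t in A) h t)%E.

Local Notation dm := (density_measure mh h0).

Let dm0 : dm set0 = 0%E.
Proof. exact: integral_set0. Qed.

Let dm_ge0 A : (0 <= dm A)%E.
Proof. by apply: integral_ge0. Qed.

Let dm_sigma_additive : semi_sigma_additive dm.
Proof.
move=> F mF tF mUF; rewrite /density_measure ge0_integral_bigcup//; last first.
  exact: measurable_funTS.
by apply: is_cvg_ereal_nneg_natsum => n _; exact: dm_ge0.
Qed.

HB.instance Definition _ := isMeasure.Build _ _ R dm dm0 dm_ge0 dm_sigma_additive.

End density_measure.

(** The exceptional sets are chosen for the countably many sets of a generating
    pi-system; outside their union, the two finite measures coincide. *)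
Lemma ae_measure_eq (R : realType) d d' (T : measurableType d)
    (Omega : measurableType d') (P : {measure set Omega -> \bar R})
    (m1 m2 : Omega -> {measure set T -> \bar R}) :
  standard_borel R T -> (forall w, (m1 w setT < +oo)%E) ->
  (forall A, measurable A -> \forall w \ae P, m1 w A = m2 w A) ->
  \forall w \ae P, forall A, measurable A -> m1 w A = m2 w A.
Proof.
move=> hT fin12 e12; have [G [mG sG iG [n0 Gn0]]] := standard_borel_pi_system hT.
have := ae_foralln (fun n => e12 (G n) (mG n)).
apply: filterS => w hw A mA.
apply: (measure_unique (range G) (fun _ => setT) sG iG) => //.
- by move=> _; exists n0.
- by rewrite bigcup_const//; exists 0%N.
- by move=> _ [n _ <-].
Qed.

(** On the set where [a] is at most [n], the identity makes both functions
    integrable, and functions with the same integrals over all sets agree almost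
    everywhere; these sets exhaust the space because [a] is finite. *)
Lemma ae_eq_testing (R : realType) d d' (S : measurableType d)
    (Omega : measurableType d') (P : probability Omega R) (U : Omega -> S)
    (a b : S -> \bar R) :
  measurable_fun setT U -> measurable_fun setT a -> measurable_fun setT b ->
  (forall x, (0 <= a x)%E) -> (forall x, (0 <= b x)%E) -> (forall x, (a x < +oo)%E) ->
  (forall B, measurable B ->
    \int[P]_w ((\1_B (U w))%:E * a (U w)) = \int[P]_w ((\1_B (U w))%:E * b (U w)))%E ->
  \forall w \ae P, a (U w) = b (U w).
Proof.
move=> mU ma mb a0 b0 afin ab.
pose law : {measure set S -> \bar R} := pushforward P U.
pose Q := law mU.
pose D (n : nat) := [set x | (a x <= n%:R%:E)%E].
have mD n : measurable (D n).
  rewrite -[D n]setTI; exact: emeasurable_fun_infty_c.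
have intE (h : S -> \bar R) B : measurable_fun setT h -> (forall x, (0 <= h x)%E) ->
    measurable B -> (\int[Q]_(x in B) h x = \int[P]_w ((\1_B (U w))%:E * h (U w)))%E.
  move=> mh h0 mB; rewrite /Q /law ge0_integral_pushforward//; last exact: measurable_funTS.
  rewrite integral_mkcond; apply: eq_integral => w _; rewrite patchE indicE /=.
  have -> : (w \in U @^-1` B) = (U w \in B) by apply/idP/idP; rewrite !inE.
  by case: ifP; rewrite ?mul1e ?mul0e.
have aen n : \forall w \ae P, D n (U w) -> a (U w) = b (U w).
  have : ae_eq Q (D n) a b.
    apply: integral_ae_eq => //.
    - apply/integrableP; split; first exact: measurable_funTS.
      apply: (@le_lt_trans _ _ (\int[Q]_(x in D n) n%:R%:E)%E).
        apply: ge0_le_integral => //.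
        + by apply: measurable_funTS; exact: measurableT_comp.
        + by move=> x Dx; rewrite gee0_abs.
      rewrite integral_cst// lte_mul_pinfty// ?lee_fin//.
      have : P (U @^-1` D n) \is a fin_num.
        by apply: fin_num_measure; rewrite -[X in measurable X]setTI; exact: (mU measurableT _ (mD n)).
      by rewrite ge0_fin_numE.
    - exact: measurable_funTS.
    - by move=> B BD mB; rewrite !intE// ab.
  move=> [N [mN QN subN]].
  exists (U @^-1` N); split => //.
    by rewrite -[_ @^-1` _]setTI; exact: (mU measurableT _ mN).
  by move=> w hw; apply: subN.
apply: filterS (ae_foralln aen) => w hw.
have [n an] : exists n : nat, (a (U w) <= n%:R%:E)%E.
  have afw : a (U w) \is a fin_num by rewrite ge0_fin_numE.
  exists (Num.truncn (fine (a (U w)))).+1.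
  rewrite -(fineK afw) lee_fin ltW//; exact: truncnS_gt.
exact: hw an.
Qed.

(** * From the Girsanov formula to chaos *)

Section backward.
Context (R : realType) (d d' : measure_display)
  (T : measurableType d) (Omega : measurableType d')
  (mu : {finite_measure set T -> \bar R}) (P : probability Omega R)
  (nu : {finite_measure set T -> \bar R}) (hmunu : mu `<< nu)
  (X : L2 nu -> L2 P) (hX : gaussian_field X)
  (C : L2 nu -> L2 nu) (hC : covariance_operator X C)
  (I : countType) (g : I -> L2 nu) (hg : orthonormal_basis g)
  (M : R.-ftker Omega ~> T)
  (m : R.-ftker seqspace I R ~> T) (hm : represents g X M m).

(** The orthonormal family spans, and [X] is bounded: coordinates suffice to
    approximate Gaussian variables. *)
Lemma gaussian_limit_field_comb z : gaussian_limit X z ->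
  forall e, 0 < e -> exists s, norm2 (z - field_comb X g s) < e.
Proof.
have [lin _ _] := hX; have [c c0 Xc] := field_bounded hX.
move=> hz e e0; have e20 : 0 < e / 2 by rewrite divr_gt0.
have [f zf] := hz _ e20.
have e2c0 : 0 < e / 2 / (c + 1) by rewrite divr_gt0// ltr_wpDl.
have : closed_span (range g) f by rewrite hg.2.
move=> /(_ _ e2c0)[n [a [v [gv]]]]; rewrite normL2E lte_fin => fv.
have /choice[j gj] : forall i, exists k, g k = v i.
  by move=> i; have [k _ <-] := gv i; exists k.
exists [seq (j i, a i) | i <- index_enum 'I_n].
set y := field_comb _ _ _; set u := \sum_i a i *: v i in fv.
have yX : \forall w \ae P, X u w = y w.
  apply: filterS (field_sum hX (index_enum _) a v) => w ->.
  by rewrite /y /field_comb big_map !L2_sumE; apply: eq_bigr => i _; rewrite gj.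
apply: le_lt_trans (norm2_subadd _ (X f) _) _.
rewrite [e]splitr ltrD// (_ : norm2 (X f - y) = norm2 (X ((-1) *: u + f))); last first.
  apply: ae_eq_norm2; apply: filterS2 yX (lin (-1) u f) => w yw ->.
  by rewrite L2_addE L2_oppE -yw; ring.
apply: le_lt_trans (Xc _) _.
rewrite scaleN1r addrC; move: fv; rewrite ltr_pdivlMr ?ltr_wpDl// => fv.
by apply: le_lt_trans fv; rewrite mulrC ler_wpM2l ?norm2_ge0// lerDl.
Qed.

(** The Cameron-Martin function depends continuously on the Gaussian variable
    which represents it, so one sequence of coefficients serves for both. *)
Lemma cameron_martin_approx (xi : L2 nu) (z : L2 P) :
  gaussian_limit X z -> (forall h, dotp xi h = dotp z (X h)) ->
  exists s : nat -> seq (I * R),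
    (\forall w \ae P, field_comb X g (s n) w @[n --> \oo] --> z w) /\
    (\forall t \ae mu, covariance_comb C g (s n) t @[n --> \oo] --> xi t).
Proof.
move=> hz zxi; have [c c0 Xc] := field_bounded hX.
have /choice[s hs] : forall n : nat, exists s,
    norm2 (z - field_comb X g s) < 2^-1 ^+ n / (c + 1).
  move=> n; apply: gaussian_limit_field_comb => //.
  by rewrite divr_gt0 ?exprn_gt0// ltr_wpDl.
have c1 : 0 < c + 1 by rewrite ltr_wpDl.
exists s; split.
  apply: L2_fast_cvg_ae => n; apply: le_trans (ltW (hs n)) _.
  by rewrite ler_pdivrMr// ler_peMr ?exprn_ge0// lerDr.
suff : \forall t \ae nu, covariance_comb C g (s n) t @[n --> \oo] --> xi t.
  move=> [N [mN N0 sub]]; exists N; split => //.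
  by have /null_content_dominatesP := hmunu; apply.
apply: L2_fast_cvg_ae => n; set D := xi - _.
have DD : norm2 D ^+ 2 <= norm2 (z - field_comb X g (s n)) * (c * norm2 D).
  rewrite norm2_sqr {1}/D -scaleN1r dotpDl dotpZl zxi (dotp_covariance_comb hC).
  rewrite -dotpZl -dotpDl scaleN1r.
  apply: (le_trans (ler_norm _)); apply: (le_trans (cauchy_schwarz _ _)).
  by rewrite ler_wpM2l ?norm2_ge0.
have [D0|D0] := eqVneq (norm2 D) 0; first by rewrite D0 exprn_ge0.
have Dpos : 0 < norm2 D by rewrite lt_neqAle eq_sym D0 norm2_ge0.
move: DD; rewrite expr2 mulrA ler_pM2r// => /le_trans; apply.
have := hs n; rewrite ltr_pdivlMr// => /ltW; apply: le_trans.
by rewrite ler_wpM2l ?norm2_ge0// lerDl.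
Qed.

Hypothesis girsanov : forall f : seqspace I R * T -> \bar R,
  measurable_fun [set: seqspace I R * T] f -> (forall z, (0 <= f z)%E) ->
  (\int[P]_w \int[M w]_t f (field_coord g X w, t) =
   \int[P]_w \int[mu]_t f (shift_cov g X C t w, t))%E.

Lemma girsanov_mean (A : set T) : measurable A -> mean_measure P M A = mu A.
Proof.
move=> mA.
have mf : measurable_fun setT (fun z : seqspace I R * T => (\1_A z.2)%:E : \bar R).
  by apply/measurable_EFinP; exact: measurableT_comp.
have f0 (z : seqspace I R * T) : (0 <= (\1_A z.2)%:E :> \bar R)%E by rewrite lee_fin.
have /= := girsanov mf f0.
under eq_integral do rewrite integral_indic// setIT.
rewrite /mean_measure => ->.
by rewrite integral_indic// setIT prob_integral_cst.
Qed.

Hypothesis hT : standard_borel R T.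

(** Both [m (X + xi) A] and the integral of [exp xi] over [A] are tested against
    the indicators of events [X + xi \in B], and both expectations reduce to the
    integral of the function [H] below. *)
Lemma girsanov_chaos (xi : L2 nu) : cameron_martin X xi ->
  \forall w \ae P, forall A : set T, measurable A ->
    m (shift_cm g X xi w) A = (\int[M w]_(t in A) (expR (xi t))%:E)%E.
Proof.
move=> [z hz zxi]; have {}hz := closed_span_gaussian_limit hX hz.
have [s [fcv ccv]] := cameron_martin_approx hz zxi.
set v := dotp z z.
have mexi : measurable_fun setT (fun t => (expR (xi t))%:E).
  by apply/measurable_EFinP; apply: measurableT_comp => //; exact: measurable_L2.
have exi0 t : (0 <= (expR (xi t))%:E)%E by rewrite lee_fin expR_ge0.
have mfc := measurable_field_coord X g.
pose U w : seqspace I R := shift_cm g X xi w.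
have UE w : U w = fun i => X (g i) w + dotp z (X (g i)).
  by apply/funext => i; rewrite /U /shift_cm zxi.
have mU : measurable_fun setT U.
  apply: measurable_to_seqspace => i.
  by apply: measurable_funD => //; exact: measurable_L2.
pose sc (u : Omega * T) : seqspace I R := shift_cov g X C u.2 u.1.
have msc : measurable_fun setT sc.
  apply: measurable_to_seqspace => i; apply: measurable_funD.
    by apply: measurableT_comp => //; exact: measurable_L2.
  by apply: measurableT_comp => //; exact: measurable_L2.
have madd (y : seqspace I R) :
    measurable_fun setT (fun x : seqspace I R => (fun i => x i + y i) : seqspace I R).
  apply: measurable_to_seqspace => i; apply: measurable_funD => //.
  exact: measurable_coord.
pose D w := expR (z w - v / 2).
have mD : measurable_fun setT (fun w => (D w)%:E).
  apply/measurable_EFinP; apply: measurableT_comp => //.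
  by apply: measurable_funD => //; exact: measurable_L2.
have D0 w : (0 <= (D w)%:E)%E by rewrite lee_fin expR_ge0.
(* The density [exp (z - v / 2)] as a function of the coordinates of the field.
   The upper limit is defined everywhere, so it can be evaluated at shifted
   fields too; the absolute value makes it nonnegative. *)
pose G (x : seqspace I R) :=
  `|limn_esup (fun n => (expR (coord_comb (s n) x - v / 2))%:E)|%E.
have mG : measurable_fun setT G.
  apply: measurableT_comp => //; apply: measurable_fun_limn_esup => n.
  apply/measurable_EFinP; apply: measurableT_comp => //.
  by apply: measurable_funD => //; exact: measurable_coord_comb.
have GE x r : coord_comb (s n) x @[n --> \oo] --> r -> G x = (expR (r - v / 2))%:E.
  move=> h.
  have h1 : coord_comb (s n) x - v / 2 @[n --> \oo] --> r - v / 2.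
    by apply: cvgB => //; exact: cvg_cst.
  have h2 : (expR (coord_comb (s n) x - v / 2))%:E @[n --> \oo] --> (expR (r - v / 2))%:E.
    apply: cvg_EFin; first exact: nearW.
    exact: (cvg_comp _ _ h1 (@continuous_expR R _)).
  rewrite /G is_cvg_limn_esupE; last by apply/cvg_ex; eexists; exact: h2.
  by rewrite (cvg_lim (@ereal_hausdorff R) h2) gee0_abs// lee_fin expR_ge0.
apply: (@ae_measure_eq _ _ _ _ _ _ (fun w => m (U w))
  (fun w => density_measure (M w) mexi exi0) hT).
  by move=> w; rewrite -ge0_fin_numE//; exact: kernel_finite_transition.
move=> A mA.
pose e t : \bar R := (\1_A t * expR (xi t))%:E.
have me : measurable_fun setT e.
  by apply/measurable_EFinP; apply: measurable_funM => //; exact/measurable_EFinP.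
have e0 t : (0 <= e t)%E by rewrite lee_fin mulr_ge0// expR_ge0.
pose a (x : seqspace I R) := m x A.
pose b (x : seqspace I R) := (\int[m (fun i => x i + - dotp xi (g i))%R]_t e t)%E.
have ma : measurable_fun setT a by exact: measurable_kernel.
have mb : measurable_fun setT b.
  exact: (measurableT_comp (measurable_kernel_integral m me e0) (madd (fun i => - dotp xi (g i)))).
have b0 x : (0 <= b x)%E by exact: integral_ge0.
have bU w : b (U w) = (\int[m (field_coord g X w)]_t e t)%E.
  by rewrite /b; congr integral; congr (m _); apply/funext => i; rewrite /U /shift_cm addrK.
suff : \forall w \ae P, a (U w) = b (U w).
  apply: filterS2 (represents_integral hm e) => w he ab.
  rewrite -[LHS]/(a (U w)) ab bU -he.
  rewrite /density_measure [RHS]integral_mkcond; apply: eq_integral => t _.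
  by rewrite /e patchE indicE; case: (_ \in _); rewrite ?mul1r ?mul0r.
apply: ae_eq_testing => //.
  by move=> x; rewrite -ge0_fin_numE//; exact: kernel_finite_transition.
move=> B mB; pose F (x : seqspace I R) : \bar R := (\1_B x)%:E.
have mF : measurable_fun setT F by exact/measurable_EFinP.
have F0 x : (0 <= F x)%E by rewrite lee_fin.
pose H (u : Omega * T) := ((D u.1)%:E * F (sc u) * e u.2)%E.
have mH : measurable_fun setT H.
  apply: emeasurable_funM; last exact: (measurableT_comp me).
  by apply: emeasurable_funM; [exact: (measurableT_comp mD)|exact: (measurableT_comp mF)].
have H0 u : (0 <= H u)%E by rewrite mule_ge0// mule_ge0.
transitivity (\int[P]_w \int[mu]_t H (w, t))%E.
  pose f1 (u : seqspace I R * T) := (G u.1 * F u.1 * (\1_A u.2)%:E)%E.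
  have mf1 : measurable_fun setT f1.
    apply: emeasurable_funM.
      by apply: emeasurable_funM; [exact: (measurableT_comp mG)|exact: (measurableT_comp mF)].
    by apply/measurable_EFinP; exact: measurableT_comp.
  have f10 u : (0 <= f1 u)%E.
    by rewrite mule_ge0 ?lee_fin//; apply: mule_ge0 => //; exact: abse_ge0.
  have mFa : measurable_fun setT (fun x => F x * a x)%E by exact: emeasurable_funM.
  have Fa0 x : (0 <= F x * a x)%E by rewrite mule_ge0.
  under eq_integral do rewrite UE.
  rewrite (cameron_martin_formula hX g hz mFa Fa0).
  transitivity (\int[P]_w \int[M w]_t f1 (field_coord g X w, t))%E.
    apply: ae_eq_integral => //.
    - by apply: emeasurable_funM => //; exact: (measurableT_comp mFa).
    - apply: (@measurable_kfcomp _ _ _ _ _ M (fun u : Omega * T => f1 (field_coord g X u.1, u.2))) => //.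
      apply: (measurableT_comp mf1); apply: measurable_fun_pair => //.
      exact: measurableT_comp.
    - apply: filterS2 hm fcv => w hw fw _.
      rewrite /f1 /= (GE _ (z w)); last by under eq_cvg do rewrite coord_comb_field.
      rewrite ge0_integralZl//.
      + by rewrite integral_indic// setIT hw// muleA.
      + by apply/measurable_EFinP.
      + by rewrite mule_ge0.
  rewrite girsanov//.
  have mq (h : Omega * T -> \bar R) w : measurable_fun setT h ->
      measurable_fun setT (fun t => h (w, t)).
    by move=> mh; exact: measurable_fun_pair2.
  have mf1s : measurable_fun setT (fun u : Omega * T => f1 (sc u, u.2)).
    by apply: (measurableT_comp mf1); exact: measurable_fun_pair.
  apply: ae_eq_integral => //.
  - exact: (@measurable_fun_fubini_tonelli_F _ _ _ _ _ mu (fun u : Omega * T => f1 (sc u, u.2))).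
  - exact: (@measurable_fun_fubini_tonelli_F _ _ _ _ _ mu H).
  - apply: filterS fcv => w fw _.
    apply: ae_eq_integral => //.
    + exact: (mq _ w mf1s).
    + exact: (mq _ w mH).
    + apply: filterS ccv => t ct _.
      rewrite /f1 /H /= (GE _ (z w + xi t)).
        rewrite /F -!EFinM; congr _%:E.
        rewrite (_ : z w + xi t - v / 2 = (z w - v / 2) + xi t); last by ring.
        by rewrite expRD -/(D w); ring.
      under eq_cvg do rewrite coord_combD coord_comb_field coord_comb_covariance.
      exact: cvgD.
pose f2 (u : seqspace I R * T) := (F (fun i => u.1 i + dotp z (X (g i)))%R * e u.2)%E.
have mf2 : measurable_fun setT f2.
  apply: emeasurable_funM; last exact: (measurableT_comp me).
  apply: (measurableT_comp mF).
  exact: (measurableT_comp (madd (fun i => dotp z (X (g i)))) measurable_fst).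
have f20 u : (0 <= f2 u)%E by rewrite mule_ge0.
transitivity (\int[P]_w \int[M w]_t f2 (field_coord g X w, t))%E; last first.
  apply: ae_eq_integral => //.
  - apply: (@measurable_kfcomp _ _ _ _ _ M (fun u : Omega * T => f2 (field_coord g X u.1, u.2))) => //.
    apply: (measurableT_comp mf2); apply: measurable_fun_pair => //.
    exact: measurableT_comp.
  - by apply: emeasurable_funM; [exact: (measurableT_comp mF)|exact: (measurableT_comp mb)].
  - apply: filterS (represents_integral hm e) => w he _.
    rewrite bU -he /f2 /= ge0_integralZl//.
    by rewrite UE.
rewrite girsanov//.
have mH2 : measurable_fun setT (fun u : Omega * T => f2 (sc u, u.2)).
  by apply: (measurableT_comp mf2); exact: measurable_fun_pair.
rewrite (fubini_tonelli (fun u : Omega * T => f2 (sc u, u.2)))//.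
rewrite (fubini_tonelli H)//.
apply: eq_integral => t _; rewrite /fubini_G.
pose Ft (x : seqspace I R) := F (fun i => x i + C (g i) t).
have mFt : measurable_fun setT Ft.
  exact: (measurableT_comp mF (madd (fun i => C (g i) t))).
rewrite /H /f2 /=.
have msct : measurable_fun setT (fun w => sc (w, t)) by exact: (measurable_fun_pair1 t msc).
have mm : measurable_fun setT
    (fun w => (fun i => sc (w, t) i + dotp z (X (g i))) : seqspace I R).
  exact: (measurableT_comp (madd (fun i => dotp z (X (g i)))) msct).
have mm1 : measurable_fun setT (fun w => F (fun i => sc (w, t) i + dotp z (X (g i)))).
  exact: (measurableT_comp mF mm).
have mm2 : measurable_fun setT (fun w => (D w)%:E * F (sc (w, t)))%E.
  by apply: emeasurable_funM => //; exact: (measurableT_comp mF msct).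
rewrite !ge0_integralZr//; last by move=> w _; rewrite mule_ge0.
congr (_ * e t)%E.
rewrite -(cameron_martin_formula hX g hz mFt (fun x => F0 _)).
apply: eq_integral => w _; congr F; apply/funext => i.
by rewrite /sc /shift_cov /= addrAC.
Qed.

End backward.

Theorem theorem4 (R : realType) (d d' : measure_display)
  (T : measurableType d) (Omega : measurableType d')
  (mu : {finite_measure set T -> \bar R}) (P : probability Omega R)
  (hT : standard_borel R T) (hP : standard_probability P)
  (nu : {finite_measure set T -> \bar R})
  (hnumu : nu `<< mu) (hmunu : mu `<< nu)
  (X : L2 nu -> L2 P) (hX : gaussian_field X)
  (C : L2 nu -> L2 nu) (hC : covariance_operator X C)
  (I : countType) (g : I -> L2 nu) (hg : orthonormal_basis g)
  (M : R.-ftker Omega ~> T) (hM : random_measure P mu M)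
  (hMX : field_measurable X M)
  (m : R.-ftker seqspace I R ~> T) (hm : represents g X M m) :
  (subcritical_gmc g mu X M m /\
   (forall A : set T, measurable A -> mean_measure P M A = mu A))
  <->
  (forall f : seqspace I R * T -> \bar R,
     measurable_fun [set: seqspace I R * T] f -> (forall z, (0 <= f z)%E) ->
     (\int[P]_w \int[M w]_t f (field_coord g X w, t) =
      \int[P]_w \int[mu]_t f (shift_cov g X C t w, t))%E).
Proof.
split.
  by move=> [[[_ _ _ gmcM] _] EM] f mf f0; exact: (chaos_girsanov hX hC hm gmcM EM).
move=> girsanov.
have EM (A : set T) : measurable A -> mean_measure P M A = mu A.
  exact: girsanov_mean girsanov A.
split => //; split; first split => //.
  by move=> xi; exact: (girsanov_chaos hmunu hX hC hg hm girsanov hT).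
exists (fun _ => setT); first by rewrite bigcup_const//; exists 0%N.
by move=> _; split => //; rewrite EM// -ge0_fin_numE ?fin_num_measure.
Qed.
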